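(* Let $G\subset\mathbb{C}$ be an open set, let $f$ be a function meromorphic on an open set $G'\supset \mathrm{cl}(G)$, let $\epsilon\in(0,\infty)$, and let $\Lambda$ be a bounded connected component of the level set $E_{f,\epsilon}=\{z\in G' : |f(z)|=\epsilon\}$ with $\Lambda\subset G$. Then $\Lambda$ is a planar graph.
   Context: A planar graph means a finite graph embedded in a plane or sphere whose edges do not cross (loops and multiple edges are allowed); a simple closed path (with no vertices) is also counted as a planar graph. A level set of $f$ is a set $E_{f,\epsilon}$, and a level curve of $f$ is a connected component of a level set. *)

(* Defs.v *)
From HB Require Import structures.
From mathcomp Require Import all_boot all_order all_algebra.
From mathcomp Require Import complex.
From mathcomp Require Import all_classical all_reals all_analysis.
Set Implicit Arguments.
Unset Strict Implicit.
Unset Printing Implicit Defensive.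
Import Order.TTheory GRing.Theory Num.Theory.
Import numFieldNormedType.Exports.
Local Open Scope classical_set_scope.
Local Open Scope ring_scope.
Local Open Scope complex_scope.

(* A numClosedFieldType-valued alias of R[i]: the topology and the normed module
   structure of a numClosedFieldType are found through this key, whereas they
   are not found on the bare carrier R[i]. The norm `|z| is complex-valued. *)
Definition Cplx (R : realType) : numClosedFieldType := R[i].

(* The point at infinity is None. *)
Definition sphere (R : realType) : Type := one_point_compactification (Cplx R).

(* The value 0 at infinity is a dummy: it is never used at a pole. *)
Definition finite_value (R : realType) (w : sphere R) : Cplx R := odflt 0 w.

(* derivable uses increments h in Cplx R, so derivability in the direction 1
   is complex differentiability. *)
Record meromorphic_on (R : realType) (f : Cplx R -> sphere R)
    (U : set (Cplx R)) : Prop := MeromorphicOn {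
  meromorphic_isolated : forall z, U z -> \forall w \near z^', f w <> None;
  meromorphic_derivable : forall z, U z -> f z <> None ->
    derivable (fun w => finite_value (f w)) z 1;
  meromorphic_pole : forall z, U z -> f z = None ->
    `|finite_value (f w)| @[w --> z^'] --> +oo
}.

Definition level_set (R : realType) (f : Cplx R -> sphere R)
    (U : set (Cplx R)) (eps : R) : set (Cplx R) :=
  [set z | [/\ U z, f z <> None & `|finite_value (f z)| = eps%:C]].

Definition is_component (T : topologicalType) (A L : set T) : Prop :=
  exists2 x, A x & L = connected_component A x.

(* The edges are the arcs and loops g i, parametrized by [0, 1]; the arc (or
   loop) i minus its ends is g i @` `]0, 1[. *)
Record graph_embedding (R : realType) (V : set (Cplx R)) (n : nat)
    (g : 'I_n -> R -> Cplx R) : Prop := GraphEmbedding {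
  graph_finite : finite_set V;
  graph_continuous : forall i, {within `[0, 1], continuous (g i)};
  graph_ends : forall i, V (g i 0) /\ V (g i 1);
  graph_injective : forall i, {in `]0, 1[ &, injective (g i)};
  graph_vertices : forall i, [disjoint g i @` `]0, 1[ & V];
  graph_edges : forall i j, i != j ->
    [disjoint g i @` `]0, 1[ & g j @` `]0, 1[]
}.

Definition simple_closed_path (R : realType) (c : R -> Cplx R) : Prop :=
  [/\ {within `[0, 1], continuous c}, c 0 = c 1 &
      {in `[0, 1[ &, injective c}].

(* A planar graph is identified with the point set that it occupies. *)
Definition planar_graph (R : realType) (L : set (Cplx R)) : Prop :=
  (exists V n (g : 'I_n -> R -> Cplx R), graph_embedding V g /\
     L = V `|` \bigcup_i (g i @` `[0, 1]))
  \/ (exists2 c : R -> Cplx R, simple_closed_path c & L = c @` `[0, 1]).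

(* Main.v *)
(* The level set is closed in G', so L is compact. Near a point z of L, the
   function g = (f - f z) / (f + f z) is holomorphic, and |f| = |f z| means
   Re g = 0. Either g vanishes near z, or g = phi ^ k with phi a local
   homeomorphism, and then the level set near z consists of 2k arcs issued from
   z. The first case is excluded: the points of L interior to the level set form
   an open and compact set, on which Re would have no maximum. By compactness
   finitely many arcs, relatively open in L up to their ends, cover L. Cut at
   the set V of all their ends, two such open arcs are equal or disjoint, since
   each is open and closed in the other; so V and these arcs form a graph.
   A closed curve is a graph with a vertex of degree two.

   The normal form g = phi ^ k comes from complex differentiability alone.
   Goursat's theorem on triangles gives, for a square contour around z,
   g w * K w = \oint g x / (x - w) dx, with K w = \oint dx / (x - w) nonzero near
   w = z; expanding 1 / (x - w) to finite order in w - z gives g = (w - z) ^ k h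
   with h Lipschitz and h z <> 0. *)

Require Import Defs.
From mathcomp Require Import all_boot all_order all_algebra.
From mathcomp Require Import complex finmap.
From mathcomp Require Import all_classical all_reals all_analysis.
From mathcomp Require Import ring lra.
Set Implicit Arguments.
Unset Strict Implicit.
Unset Printing Implicit Defensive.
Import Order.TTheory GRing.Theory Num.Theory.
Import numFieldNormedType.Exports.
Import Normc.
Local Open Scope classical_set_scope.
Local Open Scope ring_scope.
Local Open Scope complex_scope.

(** * The modulus and the topology of the complex plane *)

(** Complex differentiability gives at first neither power series nor a continuous derivative, so
    the regularity used here is expressed by Lipschitz estimates. The constant 2 pi i is never
    computed: [g] is the quotient of its Cauchy integral by that of the constant 1, and a quotient
    of Lipschitz functions with nonzero denominator is Lipschitz. This is enough: if [rho] is a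
    Lipschitz k-th root of [h], then [(w - z) * rho w] differs near [z] from a linear map by a map
    of small Lipschitz constant, which makes it injective and open. The fraction
    [(f - f z) / (f + f z)] is a Cayley transform: it carries the part of the circle |u| = |f z|
    near [f z] into the imaginary axis, so that level curves become preimages of rays. The global
    obstacle is that stars around different points overlap in an uncontrolled way. Openness of each
    open arc relative to [L] settles it: this property survives cutting, and it turns overlap into
    equality by connectedness. *)

Definition cabs (R : realType) (z : Cplx R) : R := normc z.

Lemma normcE (R : realType) (z : Cplx R) : `|z| = (cabs z)%:C.
Proof. by []. Qed.

Lemma cabs_ge0 (R : realType) (z : Cplx R) : 0 <= cabs z.
Proof. by rewrite -lecR -normcE normr_ge0. Qed.

Lemma cabsD (R : realType) (z w : Cplx R) : cabs (z + w) <= cabs z + cabs w.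
Proof. exact: le_normcD. Qed.

Lemma cabsM (R : realType) (z w : Cplx R) : cabs (z * w) = cabs z * cabs w.
Proof. exact: normcM. Qed.

Lemma cabsN (R : realType) (z : Cplx R) : cabs (- z) = cabs z.
Proof. exact: normcN. Qed.

Lemma cabsV (R : realType) (z : Cplx R) : cabs z^-1 = (cabs z)^-1.
Proof. exact: normcV. Qed.

Lemma cabsC (R : realType) (z w : Cplx R) : cabs (z - w) = cabs (w - z).
Proof. by rewrite -cabsN opprB. Qed.

Lemma cabs0 (R : realType) : cabs (0 : Cplx R) = 0.
Proof. exact: normc0. Qed.

Lemma cabs1 (R : realType) : cabs (1 : Cplx R) = 1.
Proof. exact: normc1. Qed.

Lemma cabsX (R : realType) (z : Cplx R) n : cabs (z ^+ n) = cabs z ^+ n.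
Proof. by elim: n => [|n IH]; rewrite ?expr0 ?cabs1 // !exprS cabsM IH. Qed.

Lemma cabs_eq0 (R : realType) (z : Cplx R) : (cabs z == 0) = (z == 0).
Proof.
by apply/eqP/eqP => [/eq0_normc|->]; last exact: cabs0.
Qed.

Lemma cabs_gt0 (R : realType) (z : Cplx R) : (0 < cabs z) = (z != 0).
Proof. by rewrite lt_def cabs_eq0 cabs_ge0 andbT. Qed.

Lemma cabs_real (R : realType) (x : R) : cabs (x%:C : Cplx R) = `|x|.
Proof. by rewrite /cabs /= expr0n /= addr0 sqrtr_sqr. Qed.

Lemma cabs_nat (R : realType) n : cabs (n%:R : Cplx R) = n%:R.
Proof.
by rewrite -(rmorph_nat (real_complex R)) cabs_real ger0_norm.
Qed.

Lemma cabs_distD (R : realType) (y x z : Cplx R) :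
  cabs (x - z) <= cabs (x - y) + cabs (y - z).
Proof. by apply: le_trans (cabsD _ _); rewrite addrA subrK. Qed.

Lemma cabsB_ge (R : realType) (x y : Cplx R) : cabs x - cabs y <= cabs (x - y).
Proof. by rewrite lerBlDr (le_trans _ (cabsD _ _)) // subrK. Qed.

Lemma cabs_def (R : realType) (z : Cplx R) :
  cabs z ^+ 2 = complex.Re z ^+ 2 + complex.Im z ^+ 2.
Proof. by case: z => a b; rewrite /cabs /= sqr_sqrtr // addr_ge0 ?sqr_ge0. Qed.

Lemma Re_le_cabs (R : realType) (z : Cplx R) : `|complex.Re z| <= cabs z.
Proof.
rewrite -(@ler_pXn2r _ 2) ?nnegrE ?cabs_ge0 // cabs_def real_normK ?num_real //.
by rewrite lerDl sqr_ge0.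
Qed.

Lemma Im_le_cabs (R : realType) (z : Cplx R) : `|complex.Im z| <= cabs z.
Proof.
rewrite -(@ler_pXn2r _ 2) ?nnegrE ?cabs_ge0 // cabs_def real_normK ?num_real //.
by rewrite lerDr sqr_ge0.
Qed.

Lemma cabs_le_ReIm (R : realType) (z : Cplx R) :
  cabs z <= `|complex.Re z| + `|complex.Im z|.
Proof.
rewrite -(@ler_pXn2r _ 2) ?nnegrE ?cabs_ge0 ?addr_ge0 // cabs_def sqrrD.
rewrite !real_normK ?num_real // -addrA lerD2l lerDr.
by rewrite mulrn_wge0 // mulr_ge0.
Qed.

Lemma ReD (R : realType) (z w : Cplx R) :
  complex.Re (z + w) = complex.Re z + complex.Re w.
Proof. by case: z w => ? ? []. Qed.

Lemma ImD (R : realType) (z w : Cplx R) :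
  complex.Im (z + w) = complex.Im z + complex.Im w.
Proof. by case: z w => ? ? []. Qed.

Lemma ReB (R : realType) (z w : Cplx R) :
  complex.Re (z - w) = complex.Re z - complex.Re w.
Proof. by case: z w => ? ? []. Qed.

Lemma ImB (R : realType) (z w : Cplx R) :
  complex.Im (z - w) = complex.Im z - complex.Im w.
Proof. by case: z w => ? ? []. Qed.

Lemma ReM (R : realType) (z w : Cplx R) : complex.Re (z * w) =
  complex.Re z * complex.Re w - complex.Im z * complex.Im w.
Proof. by case: z w => ? ? []. Qed.

Lemma ImM (R : realType) (z w : Cplx R) : complex.Im (z * w) =
  complex.Re z * complex.Im w + complex.Im z * complex.Re w.
Proof. by case: z w => ? ? []. Qed.

Lemma complex_eq (R : realType) (z w : Cplx R) :
  complex.Re z = complex.Re w -> complex.Im z = complex.Im w -> z = w.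
Proof. by case: z w => ? ? [? ?] /= -> ->. Qed.

(** The radius of a ball is here a positive element of the complex order, hence a real number; this
    gives access to neighbourhoods through real radii and [cabs]. *)
Lemma cnbhsP (R : realType) (z : Cplx R) (P : set (Cplx R)) :
  nbhs z P <-> exists2 d : R, 0 < d & forall w, cabs (w - z) < d -> P w.
Proof.
split => [/nbhs_ballP[e /= e0 zP]|[d d0 zP]].
  have eE : e = (complex.Re e)%:C.
    by case: (e) e0 => a b; rewrite ltcE /= => /andP[/eqP -> _].
  exists (complex.Re e) => [|w wz]; first by rewrite -ltcR -eE.
  by apply: zP; rewrite /ball /= normcE eE ltcR cabsC.
apply/nbhs_ballP; exists (d%:C : Cplx R) => /=; first by rewrite ltcR.
by move=> w; rewrite /ball /= normcE ltcR cabsC; exact: zP.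
Qed.

Lemma ccvgP (R : realType) (T : Type) (F : set_system T) (FF : Filter F)
    (f : T -> Cplx R) (y : Cplx R) :
  f t @[t --> F] --> y <->
  forall e : R, 0 < e -> \forall t \near F, cabs (f t - y) < e.
Proof.
split => [fy e e0|h].
  have /fy : nbhs y [set w | cabs (w - y) < e] by apply/cnbhsP; exists e.
  by [].
move=> P /cnbhsP[d d0 yP]; rewrite /= /nbhs /=.
by apply: filterS (h d d0) => t; exact: yP.
Qed.

Lemma Re_continuous (R : realType) : continuous (@complex.Re R : Cplx R -> R).
Proof.
move=> z; apply/(@cvgrPdist_lt _ _ _ (nbhs z)) => e e0; apply/cnbhsP; exists e => // w wz /=.
by rewrite -ReB (le_lt_trans (Re_le_cabs _)) // cabsC.
Qed.

Lemma Im_continuous (R : realType) : continuous (@complex.Im R : Cplx R -> R).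
Proof.
move=> z; apply/(@cvgrPdist_lt _ _ _ (nbhs z)) => e e0; apply/cnbhsP; exists e => // w wz /=.
by rewrite -ImB (le_lt_trans (Im_le_cabs _)) // cabsC.
Qed.

Lemma Complex_continuous (R : realType) (T : Type) (F : set_system T)
    (FF : Filter F) (u v : T -> R) (x y : R) :
  u t @[t --> F] --> x -> v t @[t --> F] --> y ->
  (u t +i* v t : Cplx R) @[t --> F] --> (x +i* y : Cplx R).
Proof.
move=> ux vy; apply/ccvgP => e e0; have e20 : 0 < e / 2 by rewrite divr_gt0.
move/cvgrPdist_lt : ux => /(_ _ e20) ux.
move/cvgrPdist_lt : vy => /(_ _ e20) vy.
near=> t; rewrite (le_lt_trans (cabs_le_ReIm _)) //= [ltRHS]splitr ltrD //.
  by rewrite distrC; near: t.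
by rewrite distrC; near: t.
Unshelve. all: by end_near. Qed.

Lemma cabs_continuous (R : realType) : continuous (@cabs R).
Proof.
move=> z; apply/(@cvgrPdist_lt _ _ _ (nbhs z)) => e e0; apply/cnbhsP; exists e => // w wz /=.
have := cabsB_ge z w; have := cabsB_ge w z.
by rewrite (cabsC z w) ltr_norml => ? ?; apply/andP; split; lra.
Qed.

Lemma compact_rect (R : realType) (a b c d : R) :
  compact [set z : Cplx R |
    (a <= complex.Re z <= b) && (c <= complex.Im z <= d)].
Proof.
pose h (p : R * R) : Cplx R := p.1 +i* p.2.
have hc : {within `[a, b] `*` `[c, d], continuous h}.
  apply: continuous_subspaceT => p; apply: Complex_continuous.
    exact: cvg_fst.
  exact: cvg_snd.
have := continuous_compact hc
  (compact_setX (@segment_compact _ a b) (@segment_compact _ c d)).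
congr compact; apply/seteqP; split => [_ [[x y] [/= xab ycd] <-]|[x y] /= /andP[xab ycd]].
  by move: xab ycd; rewrite !in_itv /= => -> ->.
by exists (x, y) => //; split; rewrite /= in_itv.
Qed.

Lemma cHausdorff (R : realType) : hausdorff_space (Cplx R).
Proof. exact: norm_hausdorff. Qed.

Lemma closed_cabs_le (R : realType) (z : Cplx R) (r : R) :
  closed [set w : Cplx R | cabs (w - z) <= r].
Proof.
move=> w cw /=; rewrite leNgt; apply/negP => rw.
have /cw[v /= [vr]] : nbhs w [set v | cabs (v - w) < cabs (w - z) - r].
  by apply/cnbhsP; exists (cabs (w - z) - r) => //; rewrite subr_gt0.
by have := cabs_distD v w z; rewrite (cabsC w v); lra.
Qed.

Lemma compact_disk (R : realType) (z : Cplx R) (r : R) :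
  compact [set w : Cplx R | cabs (w - z) <= r].
Proof.
apply: (subclosed_compact (closed_cabs_le (z := z) (r := r))
  (@compact_rect R (complex.Re z - r) (complex.Re z + r)
     (complex.Im z - r) (complex.Im z + r))).
move=> w /= wr; have := le_trans (Re_le_cabs (w - z)) wr.
have := le_trans (Im_le_cabs (w - z)) wr.
rewrite ReB ImB !ler_norml => /andP[? ?] /andP[? ?].
by apply/andP; split; apply/andP; split; lra.
Qed.

Lemma compact_bounded_closed (R : realType) (A : set (Cplx R)) :
  bounded_set A -> closed A -> compact A.
Proof.
move=> [M [Mr AM]] cA.
have M0 : M < `|M| + 1 by rewrite (le_lt_trans (real_ler_norm Mr)) // ltrDl.
apply: (subclosed_compact cA (@compact_disk R 0 (cabs M + 1))) => z Az /=.
have := AM _ M0 z Az.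
by rewrite /= !normcE subr0 -(rmorph1 (real_complex R)) -rmorphD lecR.
Qed.

(** The difference quotient is cleared of its denominator, so the estimate also covers [w = z]. *)
Lemma derivable_cdiff (R : realType) (f : Cplx R -> Cplx R) (z : Cplx R) :
  derivable f z 1 -> exists d : Cplx R, forall e : R, 0 < e ->
  exists2 r : R, 0 < r & forall w, cabs (w - z) < r ->
    cabs (f w - f z - d * (w - z)) <= e * cabs (w - z).
Proof.
move=> /cvg_ex[d /= fd]; exists d => e e0.
have /(ccvgP _ _ _)/(_ e e0) := fd.
move=> /cnbhsP[r r0 H]; exists r => // w wz.
have [->|wNz] := eqVneq w z; first by rewrite !subrr mulr0 subrr cabs0 mulr0.
have wz0 : w - z != 0 by rewrite subr_eq0.
have := H (w - z); rewrite subr0 => /(_ wz wz0).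
rewrite /= /shift /= [_ *: 1]mulr1 subrK => /ltW.
rewrite -[X in _ <= X -> _](mulfK (_ : cabs (w - z) != 0)) ?cabs_eq0 // ler_pdivlMr ?cabs_gt0 //.
rewrite -cabsM; congr (cabs _ <= _).
by rewrite /GRing.scale /=; field.
Qed.

Lemma derivable_ccontinuous (R : realType) (f : Cplx R -> Cplx R) (z : Cplx R) :
  derivable f z 1 -> {for z, continuous f}.
Proof. by move=> /derivable1_diffP; exact: differentiable_continuous. Qed.

Lemma ccont_cst (R : realType) (T : topologicalType) (k : Cplx R) (x : T) :
  {for x, continuous (fun=> k)}.
Proof. exact: (@cst_continuous T (Cplx R) k). Qed.

Lemma ccontD (R : realType) (T : topologicalType) (f g : T -> Cplx R) (x : T) :
  {for x, continuous f} -> {for x, continuous g} ->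
  {for x, continuous (fun w => f w + g w)}.
Proof. by move=> fc gc; apply: (@cvgD _ _ _ _ _ f g _ _ fc gc). Qed.

Lemma ccontM (R : realType) (T : topologicalType) (f g : T -> Cplx R) (x : T) :
  {for x, continuous f} -> {for x, continuous g} ->
  {for x, continuous (fun w => f w * g w)}.
Proof. by move=> fc gc; apply: (@cvgM _ _ _ _ f g _ _ fc gc). Qed.

Lemma ccontV (R : realType) (T : topologicalType) (f : T -> Cplx R) (x : T) :
  f x != 0 -> {for x, continuous f} -> {for x, continuous (fun w => (f w)^-1)}.
Proof. by move=> f0 fc; apply: (@cvgV _ _ _ _ f _ f0 fc). Qed.

(** * Averages over [0, 1] *)

(* Continuity is two-sided, at the ends 0 and 1 too. *)
Definition cont01 (R : realType) (T : topologicalType) (u : R -> T) :=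
  forall t : R, 0 <= t <= 1 -> {for t, continuous u}.

Definition avg (R : realType) (u : R -> R) : R :=
  \int[@lebesgue_measure R]_(t in `[0, 1]) u t.

Lemma cont01_within (R : realType) (T : topologicalType) (u : R -> T) :
  cont01 u -> {within `[0, 1], continuous u}.
Proof.
move=> uc; apply: continuous_in_subspaceT => t.
by rewrite inE /= in_itv /=; exact: uc.
Qed.

Lemma cont01_integrable (R : realType) (u : R -> R) : cont01 u ->
  (@lebesgue_measure R).-integrable `[0, 1] (EFin \o u).
Proof.
move=> uc; apply: continuous_compact_integrable; first exact: segment_compact.
exact: cont01_within.
Qed.

Lemma avgE (R : realType) (u U : R -> R) : cont01 u ->
  (forall t : R, 0 <= t <= 1 -> is_derive t 1 U (u t)) -> avg u = U 1 - U 0.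
Proof.
move=> uc Uu; rewrite /avg /Rintegral (@continuous_FTC2 _ u U) //.
- exact: cont01_within.
- have Uc (t : R) : 0 <= t <= 1 -> {for t, continuous U}.
    move=> t01; have [dU _] := Uu t t01.
    by apply: differentiable_continuous; exact/derivable1_diffP.
  split.
  + by move=> t; rewrite in_itv /= => /andP[t0 t1]; case: (Uu t); rewrite ?(ltW t0) ?(ltW t1).
  + by apply: cvg_at_right_filter; apply: Uc; rewrite lexx ler01.
  + by apply: cvg_at_left_filter; apply: Uc; rewrite lexx ler01.
- move=> t; rewrite in_itv /= => /andP[t0 t1]; rewrite derive1E.
  by have [|_ ->] := Uu t; rewrite ?(ltW t0) ?(ltW t1).
Qed.

Lemma primitive01 (R : realType) (u : R -> R) : cont01 u ->
  exists U, forall t : R, 0 <= t <= 1 -> is_derive t 1 U (u t).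
Proof.
(* Clamping to [0, 1] by [k] extends [u] continuously to the whole line. The integral starts at -1,
   strictly left of 0, so that its derivative at 0 is two-sided. *)
move=> uc; pose k (t : R) := Num.max 0 (Num.min 1 t).
have k01 t : 0 <= k t <= 1.
  by rewrite /k le_max lexx /= ge_max ler01 ge_min lexx.
have kid t : 0 <= t <= 1 -> k t = t.
  by move=> /andP[t0 t1]; rewrite /k; rewrite (min_idPr t1) (max_idPr t0).
have kc : continuous k.
  move=> t; apply: continuous_max; first exact: cvg_cst.
  by apply: continuous_min; [exact: cvg_cst|exact: cvg_id].
have ukc : continuous (u \o k).
  by move=> t; apply: continuous_comp; [exact: kc|exact: uc].
exists (fun x => \int[@lebesgue_measure R]_(t in `[-1, x]) (u \o k) t).
move=> t t01.
have tt : t < t + 1 by rewrite ltrDl.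
have [] := @continuous_FTC1_closed R (u \o k) (-1) t (t + 1) tt.
- apply: continuous_compact_integrable; first exact: segment_compact.
  exact: continuous_subspaceT.
- by move/andP: t01 => [t0 _]; lra.
- exact: ukc.
- by rewrite derive1E /= kid // => dF F'; split.
Qed.

Lemma avgD (R : realType) (u v : R -> R) : cont01 u -> cont01 v ->
  avg (fun t => u t + v t) = avg u + avg v.
Proof. by move=> uc vc; rewrite /avg RintegralD //; exact: cont01_integrable. Qed.

Lemma avgZ (R : realType) (c : R) (u : R -> R) : cont01 u ->
  avg (fun t => c * u t) = c * avg u.
Proof. by move=> uc; rewrite /avg RintegralZl //; exact: cont01_integrable. Qed.

Lemma avg_cst (R : realType) (c : R) : avg (fun=> c) = c.
Proof.
have dU (t : R) : 0 <= t <= 1 -> is_derive t 1 (fun x => c * x) c.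
  move=> _; apply: is_derive_eq.
  by rewrite /GRing.scale /= ?mulr1 ?mulr0 ?addr0.
by rewrite (avgE _ dU) ?mulr1 ?mulr0 ?subr0 // => t _; exact: cvg_cst.
Qed.

Lemma avg_le (R : realType) (u v : R -> R) : cont01 u -> cont01 v ->
  (forall t : R, 0 <= t <= 1 -> u t <= v t) -> avg u <= avg v.
Proof.
move=> uc vc uv; apply: le_Rintegral => //.
  exact: cont01_integrable.
exact: cont01_integrable.
Qed.

Lemma avg_eq (R : realType) (u v : R -> R) :
  (forall t : R, 0 <= t <= 1 -> u t = v t) -> avg u = avg v.
Proof.
by move=> uv; apply: eq_Rintegral => t; rewrite inE /= in_itv /=; exact: uv.
Qed.

Lemma cont01_affine (R : realType) (T : topologicalType) (u : R -> T) (a b : R) :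
  0 <= b <= 1 -> 0 <= a + b <= 1 -> cont01 u -> cont01 (fun t => u (a * t + b)).
Proof.
move=> /andP[b0 b1] /andP[ab0 ab1] uc t /andP[t0 t1].
apply: (@continuous_comp _ _ _ (fun t => a * t + b) u).
  apply: continuousD; last exact: cvg_cst.
  by apply: continuousM; [exact: cvg_cst|exact: cvg_id].
apply: uc; have [a0|a0] := leP 0 a; apply/andP; split; nra.
Qed.

(** Affine substitution. The factor [a] stays on the left and may be negative: [a = -1] gives
    reversal, [a = 1 / 2] the two halves. *)
Lemma avg_affine (R : realType) (u U : R -> R) (a b : R) :
  0 <= b <= 1 -> 0 <= a + b <= 1 -> cont01 u ->
  (forall t : R, 0 <= t <= 1 -> is_derive t 1 U (u t)) ->
  a * avg (fun t => u (a * t + b)) = U (a + b) - U b.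
Proof.
move=> b01 ab01 uc Uu; rewrite -avgZ; last exact: cont01_affine.
have dU (t : R) : 0 <= t <= 1 ->
    is_derive t 1 (fun x => U (a * x + b)) (a * u (a * t + b)).
  move=> /andP[t0 t1]; rewrite mulrC.
  apply: (@is_derive1_comp _ U (fun t => a * t + b)).
    apply: Uu; move/andP : b01 ab01 => [b0 b1] /andP[ab0 ab1].
    by have [a0|a0] := leP 0 a; apply/andP; split; nra.
  apply: is_derive_eq.
  by rewrite /GRing.scale /= ?mulr1 ?mulr0 ?addr0.
rewrite (avgE _ dU) ?mulr1 ?mulr0 ?add0r // => t t01.
apply: continuousM; first exact: cvg_cst.
exact: (cont01_affine b01 ab01 uc).
Qed.

Lemma avg_rev (R : realType) (u : R -> R) : cont01 u ->
  avg (fun t => u (1 - t)) = avg u.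
Proof.
move=> uc; have [U Uu] := primitive01 uc.
rewrite (avgE uc Uu); have := @avg_affine _ u U (-1) 1.
rewrite lexx ler01 addNr lexx ler01 => /(_ erefl erefl uc Uu).
rewrite mulN1r => /eqP; rewrite eqr_oppLR opprB => /eqP <-.
by apply: avg_eq => t _; rewrite mulN1r addrC.
Qed.

Lemma avg_halves (R : realType) (u : R -> R) : cont01 u ->
  avg u = (avg (fun t => u (t / 2)) + avg (fun t => u (t / 2 + 1 / 2))) / 2.
Proof.
move=> uc; have [U Uu] := primitive01 uc; rewrite (avgE uc Uu).
have := @avg_affine _ u U (1 / 2) 0 _ _ uc Uu.
rewrite (_ : avg _ = avg (fun t => u (t / 2))); last first.
  by apply: avg_eq => t _; congr u; lra.
have := @avg_affine _ u U (1 / 2) (1 / 2) _ _ uc Uu.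
rewrite (_ : avg _ = avg (fun t => u (t / 2 + 1 / 2))); last first.
  by apply: avg_eq => t _; congr u; lra.
rewrite (_ : 1 / 2 + 1 / 2 = 1 :> R) ?addr0; last lra.
rewrite !lexx !ler01 /= => H1 H2.
have h : 0 <= (1 / 2 : R) <= 1 by apply/andP; split; lra.
have {}H1 := H1 h erefl; have {}H2 := H2 erefl h; lra.
Qed.

(** * Averages of complex-valued functions *)

Definition cavg (R : realType) (u : R -> Cplx R) : Cplx R :=
  avg (fun t => complex.Re (u t)) +i* avg (fun t => complex.Im (u t)).

Lemma cont01_Re (R : realType) (u : R -> Cplx R) :
  cont01 u -> cont01 (fun t => complex.Re (u t)).
Proof.
move=> uc t t01; apply: (@continuous_comp _ _ _ u); first exact: uc.
exact: Re_continuous.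
Qed.

Lemma cont01_Im (R : realType) (u : R -> Cplx R) :
  cont01 u -> cont01 (fun t => complex.Im (u t)).
Proof.
move=> uc t t01; apply: (@continuous_comp _ _ _ u); first exact: uc.
exact: Im_continuous.
Qed.

Lemma cavgD (R : realType) (u v : R -> Cplx R) : cont01 u -> cont01 v ->
  cavg (fun t => u t + v t) = cavg u + cavg v.
Proof.
move=> uc vc; apply: complex_eq; rewrite /= -avgD;
  do ?[exact: cont01_Re|exact: cont01_Im]; apply: avg_eq => t _.
  by rewrite ReD.
by rewrite ImD.
Qed.

Lemma cont01M (R : realType) (c : R) (u : R -> R) :
  cont01 u -> cont01 (fun t => c * u t).
Proof. by move=> uc t t01; apply: continuousM; [exact: cvg_cst|exact: uc]. Qed.

Lemma cavgM (R : realType) (c : Cplx R) (u : R -> Cplx R) : cont01 u ->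
  cavg (fun t => c * u t) = c * cavg u.
Proof.
move=> uc; have uR := cont01_Re uc; have uI := cont01_Im uc.
apply: complex_eq; rewrite ?ReM ?ImM /=.
  rewrite -mulNr -!avgZ // -avgD; try exact: cont01M.
  by apply: avg_eq => t _; rewrite ReM mulNr.
rewrite -!avgZ // -avgD; try exact: cont01M.
by apply: avg_eq => t _; rewrite ImM.
Qed.

Lemma cavg_cst (R : realType) (c : Cplx R) : cavg (fun=> c) = c.
Proof. by apply: complex_eq; rewrite /= avg_cst. Qed.

Lemma cavg_eq (R : realType) (u v : R -> Cplx R) :
  (forall t : R, 0 <= t <= 1 -> u t = v t) -> cavg u = cavg v.
Proof.
by move=> uv; apply: complex_eq; apply: avg_eq => t t01; rewrite uv.
Qed.

Lemma cavg_rev (R : realType) (u : R -> Cplx R) : cont01 u ->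
  cavg (fun t => u (1 - t)) = cavg u.
Proof.
move=> uc; apply: complex_eq => /=.
  by rewrite (avg_rev (cont01_Re uc)).
by rewrite (avg_rev (cont01_Im uc)).
Qed.

Lemma cavg_halves (R : realType) (u : R -> Cplx R) : cont01 u ->
  cavg u =
  (cavg (fun t => u (t / 2)) + cavg (fun t => u (t / 2 + 1 / 2))) / 2.
Proof.
move=> uc.
have -> : 2^-1 = (2^-1 : R)%:C :> Cplx R by rewrite fmorphV rmorph_nat.
apply: complex_eq.
  by rewrite ReM ReD /= (avg_halves (cont01_Re uc)) mulr0 subr0.
by rewrite ImM ImD /= (avg_halves (cont01_Im uc)) mulr0 add0r.
Qed.

Lemma avg_norm_le (R : realType) (u : R -> R) (M : R) : cont01 u ->
  (forall t : R, 0 <= t <= 1 -> `|u t| <= M) -> `|avg u| <= M.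
Proof.
move=> uc uM; rewrite ler_norml -{1}(avg_cst (- M)) -{2}(avg_cst M).
have cc (c : R) : cont01 (fun=> c : R) by move=> t _; exact: cvg_cst.
by apply/andP; split; apply: avg_le => // t /uM; rewrite ler_norml => /andP[].
Qed.

(** The factor 2 comes from bounding the real and imaginary parts separately. *)
Lemma cavg_le (R : realType) (u : R -> Cplx R) (M : R) : cont01 u ->
  (forall t : R, 0 <= t <= 1 -> cabs (u t) <= M) -> cabs (cavg u) <= 2 * M.
Proof.
move=> uc uM; apply: le_trans (cabs_le_ReIm _) _.
rewrite mulr_natl mulr2n lerD //=.
  by apply: avg_norm_le (cont01_Re uc) _ => t /uM; apply: le_trans (Re_le_cabs _).
by apply: avg_norm_le (cont01_Im uc) _ => t /uM; apply: le_trans (Im_le_cabs _).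
Qed.

(** By the symmetry [t -> 1 - t], the average equals 1 minus itself. *)
Lemma cavg_id (R : realType) : cavg (fun t : R => t%:C) = 1 / 2.
Proof.
have cid : cont01 (fun t : R => t%:C : Cplx R).
  move=> t _; rewrite /real_complex_def.
  by apply: Complex_continuous; [exact: cvg_id|exact: cvg_cst].
have cst1 : cont01 (fun t : R => 1 : Cplx R) by move=> t _; exact: cvg_cst.
have := cavg_rev cid.
rewrite (@cavg_eq _ _ (fun t : R => 1 + (-1) * t%:C)); last first.
  by move=> t _; rewrite rmorphB rmorph1 mulN1r.
have ccid : cont01 (fun t : R => (-1) * t%:C : Cplx R).
  move=> t t01; apply: continuousM; first exact: cvg_cst.
  exact: cid.
rewrite (cavgD cst1 ccid) (cavgM _ cid) cavg_cst => /eqP.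
rewrite mulN1r subr_eq -mulr2n => /eqP h.
have two0 : (2 : Cplx R) != 0 by rewrite pnatr_eq0.
by apply: (mulIf two0); rewrite divfK // mulr_natr -h.
Qed.

(** * Segment integrals and Goursat's theorem *)

Definition segpt (R : realType) (a b : Cplx R) (t : R) : Cplx R :=
  a + t%:C * (b - a).

(** The path integral along the segment from [a] to [b]; its velocity [b - a] is constant and stands
    outside the average. *)
Definition segi (R : realType) (phi : Cplx R -> Cplx R) (a b : Cplx R) :
  Cplx R := (b - a) * cavg (fun t => phi (segpt a b t)).

Definition trii (R : realType) (phi : Cplx R -> Cplx R) (a b c : Cplx R) :
  Cplx R := segi phi a b + segi phi b c + segi phi c a.

Definition cont_seg (R : realType) (phi : Cplx R -> Cplx R) (a b : Cplx R) :=
  cont01 (fun t => phi (segpt a b t)).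

Definition cconvex (R : realType) (D : set (Cplx R)) :=
  forall a b t, D a -> D b -> 0 <= t <= 1 -> D (segpt a b t).

Lemma segpt_continuous (R : realType) (a b : Cplx R) : continuous (segpt a b).
Proof.
move=> t; apply: (@cvgD _ _ _ _ _ (fun=> a) (fun t => t%:C * (b - a))); first exact: cvg_cst.
apply: cvgM; last exact: cvg_cst.
by apply: Complex_continuous; [exact: cvg_id|exact: cvg_cst].
Qed.

Lemma cont_segP (R : realType) (phi : Cplx R -> Cplx R) (a b : Cplx R) :
  (forall t : R, 0 <= t <= 1 -> {for segpt a b t, continuous phi}) ->
  cont_seg phi a b.
Proof.
move=> pc t t01; apply: (@continuous_comp _ _ _ (segpt a b)).
  exact: segpt_continuous.
exact: pc.
Qed.

Lemma segpt_rev (R : realType) (a b : Cplx R) t :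
  segpt b a t = segpt a b (1 - t).
Proof. by rewrite /segpt rmorphB rmorph1; ring. Qed.

Lemma segi_rev (R : realType) (phi : Cplx R -> Cplx R) (a b : Cplx R) :
  cont_seg phi a b -> segi phi b a = - segi phi a b.
Proof.
move=> pc; rewrite /segi -(cavg_rev pc) -mulNr opprB.
by congr (_ * _); apply: cavg_eq => t _; rewrite segpt_rev.
Qed.

Lemma half_real (R : realType) : 2^-1 = (2^-1 : R)%:C :> Cplx R.
Proof. by rewrite fmorphV rmorph_nat. Qed.

Lemma real_half (R : realType) (t : R) : (t / 2)%:C = t%:C / 2 :> Cplx R.
Proof. by rewrite half_real -rmorphM. Qed.

Lemma segi_halves (R : realType) (phi : Cplx R -> Cplx R) (a b : Cplx R) :
  cont_seg phi a b ->
  segi phi a b = segi phi a ((a + b) / 2) + segi phi ((a + b) / 2) b.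
Proof.
move=> pc; rewrite /segi (cavg_halves pc).
rewrite (@cavg_eq _ (fun t => phi (segpt a b (t / 2)))
  (fun t => phi (segpt a ((a + b) / 2) t))); last first.
  by move=> t _; rewrite /segpt real_half; congr phi; field.
rewrite (@cavg_eq _ (fun t => phi (segpt a b (t / 2 + 1 / 2)))
  (fun t => phi (segpt ((a + b) / 2) b t))); last first.
  move=> t _; rewrite /segpt -mulrDl real_half rmorphD rmorph1.
  by congr phi; field.
by field.
Qed.

Lemma segi_le (R : realType) (phi : Cplx R -> Cplx R) (a b : Cplx R) (M : R) :
  cont_seg phi a b ->
  (forall t, 0 <= t <= 1 -> cabs (phi (segpt a b t)) <= M) ->
  cabs (segi phi a b) <= 2 * M * cabs (b - a).
Proof.
move=> pc pM; rewrite /segi cabsM mulrC ler_wpM2r ?cabs_ge0 //.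
exact: cavg_le.
Qed.

Lemma segiD (R : realType) (phi psi : Cplx R -> Cplx R) (a b : Cplx R) :
  cont_seg phi a b -> cont_seg psi a b ->
  segi (fun z => phi z + psi z) a b = segi phi a b + segi psi a b.
Proof. by move=> pc qc; rewrite /segi (cavgD pc qc) mulrDr. Qed.

Lemma segiM (R : realType) (k : Cplx R) (phi : Cplx R -> Cplx R)
    (a b : Cplx R) : cont_seg phi a b ->
  segi (fun z => k * phi z) a b = k * segi phi a b.
Proof. by move=> pc; rewrite /segi (cavgM _ pc) mulrCA. Qed.

Lemma segi_eq (R : realType) (phi psi : Cplx R -> Cplx R) (a b : Cplx R) :
  (forall t, 0 <= t <= 1 -> phi (segpt a b t) = psi (segpt a b t)) ->
  segi phi a b = segi psi a b.
Proof. by move=> pq; rewrite /segi (cavg_eq pq). Qed.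

Lemma cont_seg_cst (R : realType) (k a b : Cplx R) : cont_seg (fun=> k) a b.
Proof. by move=> t _; exact: cvg_cst. Qed.

Lemma cont_seg_id (R : realType) (a b : Cplx R) : cont_seg id a b.
Proof. by move=> t _; exact: segpt_continuous. Qed.

Lemma cont_segM (R : realType) (phi psi : Cplx R -> Cplx R) (a b : Cplx R) :
  cont_seg phi a b -> cont_seg psi a b ->
  cont_seg (fun z => phi z * psi z) a b.
Proof. by move=> pc qc t t01; apply: continuousM; [exact: pc|exact: qc]. Qed.

Lemma segi_cst (R : realType) (k a b : Cplx R) :
  segi (fun=> k) a b = (b - a) * k.
Proof. by rewrite /segi cavg_cst. Qed.

Lemma segi_id (R : realType) (a b : Cplx R) :
  segi id a b = (b ^+ 2 - a ^+ 2) / 2.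
Proof.
have tc : cont01 (fun t : R => t%:C : Cplx R).
  by move=> t _; apply: Complex_continuous; [exact: cvg_id|exact: cvg_cst].
have ac : cont01 (fun t : R => a) by move=> t _; exact: cvg_cst.
have btc : cont01 (fun t : R => (b - a) * t%:C).
  by move=> t t01; apply: continuousM; [exact: cvg_cst|exact: tc].
rewrite /segi (@cavg_eq _ _ (fun t : R => a + (b - a) * t%:C)); last first.
  by move=> t _; rewrite /segpt mulrC.
by rewrite (cavgD ac btc) (cavgM _ tc) cavg_cst cavg_id; field.
Qed.

(** An affine function has a quadratic primitive, so the three sides telescope. This allows
    Goursat's argument to subtract a first-order approximation. *)
Lemma trii_affine (R : realType) (k l a b c : Cplx R) :
  trii (fun z => k + l * z) a b c = 0.
Proof.
have segiA x y : segi (fun z => k + l * z) x y =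
    (y - x) * k + l * ((y ^+ 2 - x ^+ 2) / 2).
  rewrite (@segiD _ (fun=> k) (fun z => l * z)).
  - by rewrite (segiM l (@cont_seg_id R x y)) segi_cst segi_id.
  - exact: cont_seg_cst.
  - apply: cont_segM; [exact: cont_seg_cst|exact: cont_seg_id].
by rewrite /trii !segiA; field.
Qed.

(** The midpoints cut the triangle into four; each inner edge is run through twice in opposite
    directions and cancels. *)
Lemma trii_split (R : realType) (phi : Cplx R -> Cplx R) (D : set (Cplx R))
    (a b c : Cplx R) :
  cconvex D -> (forall z, D z -> {for z, continuous phi}) ->
  D a -> D b -> D c ->
  trii phi a b c = trii phi a ((a + b) / 2) ((c + a) / 2)
    + trii phi ((a + b) / 2) b ((b + c) / 2)
    + trii phi ((c + a) / 2) ((b + c) / 2) c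
    + trii phi ((b + c) / 2) ((c + a) / 2) ((a + b) / 2).
Proof.
move=> Dc pc Da Db Dz.
have mid x y : D x -> D y -> D ((x + y) / 2).
  move=> Dx Dy; have -> : (x + y) / 2 = segpt x y 2^-1.
    by rewrite /segpt -half_real; field.
  by apply: Dc => //; apply/andP; split; lra.
have cs x y : D x -> D y -> cont_seg phi x y.
  by move=> Dx Dy; apply: cont_segP => t t01; apply: pc; exact: Dc.
have DCx := mid _ _ Db Dz; have DCy := mid _ _ Dz Da.
have DCz := mid _ _ Da Db.
rewrite /trii (segi_halves (cs _ _ Da Db)) (segi_halves (cs _ _ Db Dz)).
rewrite (segi_halves (cs _ _ Dz Da)).
set x := (b + c) / 2 in DCx *; set y := (c + a) / 2 in DCy *.
set z := (a + b) / 2 in DCz *.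
rewrite (segi_rev (cs x y DCx DCy)) (segi_rev (cs y z DCy DCz))
  (segi_rev (cs z x DCz DCx)).
by ring.
Qed.

(** The constant 6 is three sides times the factor 2 of [segi_le]. *)
Lemma trii_le (R : realType) (phi : Cplx R -> Cplx R) (D : set (Cplx R))
    (a b c : Cplx R) (M s : R) : cconvex D ->
  (forall z, D z -> {for z, continuous phi}) -> D a -> D b -> D c ->
  0 <= M ->
  (forall x y t, x \in [:: a; b; c] -> y \in [:: a; b; c] -> 0 <= t <= 1 ->
     cabs (phi (segpt x y t)) <= M) ->
  cabs (b - a) <= s -> cabs (c - b) <= s -> cabs (a - c) <= s ->
  cabs (trii phi a b c) <= 6 * M * s.
Proof.
move=> Dc pc Da Db Dz M0 pM ab bc ca.
have cs x y : D x -> D y -> cont_seg phi x y.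
  by move=> Dx Dy; apply: cont_segP => t t01; apply: pc; exact: Dc.
have seg x y : x \in [:: a; b; c] -> y \in [:: a; b; c] -> D x -> D y ->
    cabs (y - x) <= s -> cabs (segi phi x y) <= 2 * M * s.
  move=> xT yT Dx Dy xy.
  apply: le_trans (segi_le (cs x y Dx Dy) (fun t => pM x y t xT yT)) _.
  by rewrite ler_wpM2l // mulr_ge0.
have aT : a \in [:: a; b; c] by rewrite !inE eqxx.
have bT : b \in [:: a; b; c] by rewrite !inE eqxx orbT.
have cT : c \in [:: a; b; c] by rewrite !inE eqxx !orbT.
have := seg _ _ aT bT Da Db ab; have := seg _ _ bT cT Db Dz bc.
have := seg _ _ cT aT Dz Da ca; rewrite /trii.
have := cabsD (segi phi a b + segi phi b c) (segi phi c a).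
have := cabsD (segi phi a b) (segi phi b c).
lra.
Qed.

Lemma mid_segpt (R : realType) (x y : Cplx R) : (x + y) / 2 = segpt x y 2^-1.
Proof. by rewrite /segpt -half_real; field. Qed.

Lemma cconvex_mid (R : realType) (D : set (Cplx R)) (x y : Cplx R) :
  cconvex D -> D x -> D y -> D ((x + y) / 2).
Proof.
move=> Dc Dx Dy; rewrite mid_segpt; apply: Dc => //.
by apply/andP; split; lra.
Qed.

Lemma cabs_half (R : realType) (x : Cplx R) (d : R) :
  cabs x <= d -> cabs (x / 2) <= d / 2.
Proof.
by move=> xd; rewrite cabsM cabsV cabs_nat ler_pM2r // invr_gt0.
Qed.

Lemma cabs_le_eq (R : realType) (u v : Cplx R) (d : R) :
  cabs v <= d -> u = v -> cabs u <= d.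
Proof. by move=> + ->. Qed.

(** The invariant of the bisection: at each step the size [s] is halved and the lower bound [K] is
    divided by 4. *)
Definition tri_in (R : realType) (phi : Cplx R -> Cplx R) (D : set (Cplx R))
    (K s : R) (T : Cplx R * Cplx R * Cplx R) :=
  let: (a, b, c) := T in
  [/\ D a, D b & D c] /\
  [/\ cabs (b - a) <= s, cabs (c - b) <= s, cabs (a - c) <= s &
      K <= cabs (trii phi a b c)].

(** One of the four pieces carries at least a quarter of the integral. The bound on the displacement
    of the first vertex makes the successive first vertices a Cauchy sequence. *)
Lemma trii_bisect (R : realType) (phi : Cplx R -> Cplx R) (D : set (Cplx R))
    (K s : R) (T : Cplx R * Cplx R * Cplx R) : cconvex D ->
  (forall z, D z -> {for z, continuous phi}) ->
  tri_in phi D K s T ->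
  exists T', tri_in phi D (K / 4) (s / 2) T' /\ cabs (T'.1.1 - T.1.1) <= s.
Proof.
move=> Dc pc; case: T => [[a b] c] /= [[Da Db Dz] [ab bc ca KT]].
have := trii_split Dc pc Da Db Dz.
have Dx := cconvex_mid Dc Db Dz; have Dy := cconvex_mid Dc Dz Da.
have Dw := cconvex_mid Dc Da Db.
set x := (b + c) / 2 in Dx *; set y := (c + a) / 2 in Dy *.
set z := (a + b) / 2 in Dw *.
set t1 := trii phi a z y; set t2 := trii phi z b x.
set t3 := trii phi y x c; set t4 := trii phi x y z => tE.
have ab2 := cabs_half ab; have bc2 := cabs_half bc; have ca2 := cabs_half ca.
have ba2 := ab2; rewrite -cabsN in ba2.
have cb2 := bc2; rewrite -cabsN in cb2.
have ac2 := ca2; rewrite -cabsN in ac2.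
have s0 : 0 <= s by apply: le_trans ab; exact: cabs_ge0.
have [h1|h1] := leP (K / 4) (cabs t1).
  exists (a, z, y); split; last by rewrite /= subrr cabs0.
  split; [by []|split=> //].
  - by apply: (cabs_le_eq ab2); rewrite /z; field.
  - by apply: (cabs_le_eq bc2); rewrite /z /y; field.
  - by apply: (cabs_le_eq ca2); rewrite /y; field.
have [h2|h2] := leP (K / 4) (cabs t2).
  exists (z, b, x); split; last first.
    apply: (@le_trans _ _ (s / 2)); last by lra.
    by apply: (cabs_le_eq ab2); rewrite /z /=; field.
  split; [by []|split=> //].
  - by apply: (cabs_le_eq ab2); rewrite /z; field.
  - by apply: (cabs_le_eq bc2); rewrite /x; field.
  - by apply: (cabs_le_eq ca2); rewrite /x /z; field.
have [h3|h3] := leP (K / 4) (cabs t3).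
  exists (y, x, c); split; last first.
    apply: (@le_trans _ _ (s / 2)); last by lra.
    by apply: (cabs_le_eq ac2); rewrite /y /=; field.
  split; [by []|split=> //].
  - by apply: (cabs_le_eq ab2); rewrite /x /y; field.
  - by apply: (cabs_le_eq bc2); rewrite /x; field.
  - by apply: (cabs_le_eq ca2); rewrite /y; field.
(* The other three pieces stay below [K / 4], so the medial triangle must reach it. *)
have h4 : K / 4 <= cabs t4.
  have := cabsD (t1 + t2 + t3) t4; have := cabsD (t1 + t2) t3.
  by have := cabsD t1 t2; move: KT; rewrite tE; lra.
exists (x, y, z); split; last first.
  rewrite /= (_ : x - a = (b - a) / 2 + - ((a - c) / 2)); last by rewrite /x; field.
  apply: le_trans (cabsD _ _) _; lra.
split; [by []|split=> //].
- by apply: (cabs_le_eq ba2); rewrite /x /y; field.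
- by apply: (cabs_le_eq cb2); rewrite /z /y; field.
- by apply: (cabs_le_eq ac2); rewrite /x /z; field.
Qed.

Lemma half_pow_lt (R : realType) (s e : R) : 0 < e -> exists n, s / 2 ^+ n < e.
Proof.
move=> e0; exists (Num.bound (`|s| / e)).
rewrite ltr_pdivrMr ?exprn_gt0 // mulrC -ltr_pdivrMr //.
have := archi_boundP (_ : 0 <= `|s| / e); rewrite divr_ge0 ?(ltW e0) // => /(_ erefl) h.
apply: le_lt_trans (_ : `|s| / e < _); first by rewrite ler_pM2r ?invr_gt0 // ler_norm.
apply: lt_le_trans h _; rewrite -natrX ler_nat.
exact: ltnW (ltn_expl _ _).
Qed.

(** The bisected triangles shrink to a point [q]. There [phi] is affine up to an error [e1] times
    the distance, so the n-th integral is at most a constant times [e1 / 4 ^ n]. It is also at least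
    [K / 4 ^ n], and the powers of 4 cancel. *)
Lemma goursat (R : realType) (phi : Cplx R -> Cplx R) (D : set (Cplx R))
    (a b c : Cplx R) : cconvex D -> compact D ->
  (forall z, D z -> derivable phi z 1) -> D a -> D b -> D c ->
  trii phi a b c = 0.
Proof.
move=> Dc Dk dphi Da Db Dz.
have pc z : D z -> {for z, continuous phi}.
  by move=> /dphi; exact: derivable_ccontinuous.
pose s := cabs (b - a) + cabs (c - b) + cabs (a - c).
have [s1 s2 s3] : [/\ 0 <= cabs (b - a), 0 <= cabs (c - b) & 0 <= cabs (a - c)].
  by split; exact: cabs_ge0.
pose K := cabs (trii phi a b c).
(* The invariant is a premise inside the existential, so that [choice] yields a total map; off the
   invariant any value will do, here [p] itself. *)
have step (p : R * R * (Cplx R * Cplx R * Cplx R)) : exists q,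
    tri_in phi D p.1.1 p.1.2 p.2 -> [/\ q.1 = (p.1.1 / 4, p.1.2 / 2),
      tri_in phi D q.1.1 q.1.2 q.2 & cabs (q.2.1.1 - p.2.1.1) <= p.1.2].
  have [pT|pT] := pselect (tri_in phi D p.1.1 p.1.2 p.2); last by exists p.
  by have [T' [? ?]] := trii_bisect Dc pc pT; exists (p.1.1 / 4, p.1.2 / 2, T').
have [F Fp] := choice step.
pose u n := iter n F (K, s, (a, b, c)).
have uP n : (u n).1 = (K / 4 ^+ n, s / 2 ^+ n) /\
    tri_in phi D (u n).1.1 (u n).1.2 (u n).2.
  elim: n => [|n [IH1 IH2]].
    rewrite /= !expr0 !divr1; split=> //; split => //.
    by split=> //; rewrite /s; lra.
  have [E1 E2 _] := Fp _ IH2; split; last exact: E2.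
  by rewrite /u /= E1 -/(u n) IH1 /= !exprSr !invfM !mulrA.
pose p n := (u n).2.1.1.
have pS n : cabs (p n.+1 - p n) <= s / 2 ^+ n.
  by have [E1 E2] := uP n; have [_ _] := Fp _ E2; rewrite E1.
have s0 : 0 <= s by rewrite /s; lra.
(* Sum of a geometric series; the subtracted tail is kept so that the induction on [m] closes. *)
have pD n m : cabs (p (n + m)%N - p n) <= 2 * s / 2 ^+ n - 2 * s / 2 ^+ (n + m).
  elim: m => [|m IH]; first by rewrite addn0 !subrr cabs0.
  rewrite addnS; apply: le_trans (cabs_distD (p (n + m)%N) _ _) _.
  have := pS (n + m)%N; rewrite exprS invfM.
  move: IH; set X := _ / 2 ^+ (n + m); set Y := s / 2 ^+ (n + m).
  by rewrite (_ : 2 * s * (2^-1 / 2 ^+ (n + m)) = Y) /X /Y; [lra|field].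
have Dp n : D (p n).
  by have [_] := uP n; rewrite /p; case: (u n).2 => [[x y] z] [[]].
(* Compactness provides a cluster point in [D]; by [pD] it lies within [2 * s / 2 ^ n] of each
   [p n]. *)
have [q [Dq qp]] := Dk (p @ \oo) _ (filterS (fun n _ => Dp n) filterT).
have pq n : cabs (p n - q) <= 2 * s / 2 ^+ n.
  apply/ler_addgt0Pr => e e0.
  have [] := qp [set p m | m in [set m | (n <= m)%N]] [set w | cabs (w - q) < e].
  - by exists n => // m /= nm; exists m.
  - by apply/cnbhsP; exists e.
  - move=> _ [[m /= nm <-] /= mq]; apply: le_trans (cabs_distD (p m) _ _) _.
    apply: lerD (ltW mq); rewrite cabsC; have := pD n (m - n)%N.
    rewrite subnKC // => h; apply: le_trans h _; rewrite gerBl.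
    by rewrite divr_ge0 ?mulr_ge0 // exprn_ge0.
have [d dq] := derivable_cdiff (dphi _ Dq).
apply/eqP; rewrite -cabs_eq0 eq_le cabs_ge0 andbT -/K.
apply/ler_addgt0Pr => e e0; rewrite add0r.
(* 24 is the 6 of [trii_le] times 4, since points on the sides are within [4 * s / 2 ^ n] of [q].
   Using [s + 1] keeps the denominator positive when [s = 0]. *)
pose e1 := e / (24 * (s + 1) ^+ 2).
have S1 : 0 < 24 * (s + 1) ^+ 2 by rewrite mulr_gt0 // exprn_gt0 //; lra.
have e10 : 0 < e1 by rewrite divr_gt0.
have [r r0 qr] := dq _ e10.
have [n nr] := half_pow_lt (4 * s) r0.
have [E1 E2] := uP n; move: E2; have := pq n; rewrite /p.
case E : (u n).2 => [[x y] z] /=.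
rewrite E1 /= => xq [[Dx Dy Dzz] [xy yz zx KT]].
(* [err] is [phi] minus its first-order approximation at [q]; by [trii_affine] it has the same
   integral over the triangle. *)
pose k := - (phi q - d * q).
pose err w := phi w + (k + (- d) * w).
have affc w : {for w, continuous (fun w => k + (- d) * w)}.
  apply: ccontD; first exact: ccont_cst.
  by apply: ccontM; [exact: ccont_cst|exact: cvg_id].
have errc w : D w -> {for w, continuous err}.
  by move=> Dw; apply: ccontD; [exact: pc|exact: affc].
have triE : trii phi x y z = trii err x y z.
  have cs v w : D v -> D w -> cont_seg phi v w.
    by move=> Dv Dw; apply: cont_segP => t t01; apply: pc; exact: Dc.
  have ca v w : cont_seg (fun w => k + (- d) * w) v w.
    by apply: cont_segP => t t01; exact: affc.
  have := trii_affine k (- d) x y z.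
  rewrite /trii (segiD (cs x y Dx Dy) (ca _ _)) (segiD (cs y z Dy Dzz) (ca _ _)).
  rewrite (segiD (cs z x Dzz Dx) (ca _ _)) => h.
  by rewrite -[LHS]addr0 -h; ring.
have s2n : 0 <= s / 2 ^+ n by rewrite divr_ge0 // exprn_ge0.
have near w : w \in [:: x; y; z] -> cabs (w - q) <= 3 * (s / 2 ^+ n).
  have xq' : cabs (x - q) <= 2 * (s / 2 ^+ n) by rewrite mulrA.
  rewrite !inE => /or3P[]/eqP->; first by lra.
    by apply: le_trans (cabs_distD x _ _) _; lra.
  by apply: le_trans (cabs_distD x _ _) _; have := zx; rewrite cabsC; lra.
have side v w : v \in [:: x; y; z] -> w \in [:: x; y; z] ->
    cabs (w - v) <= s / 2 ^+ n.
  by rewrite !inE => /or3P[]/eqP-> /or3P[]/eqP->; rewrite ?subrr ?cabs0 // cabsC.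
have errM v w t : v \in [:: x; y; z] -> w \in [:: x; y; z] -> 0 <= t <= 1 ->
    cabs (err (segpt v w t)) <= e1 * (4 * (s / 2 ^+ n)).
  move=> vT wT /andP[t0 t1].
  have sq : cabs (segpt v w t - q) <= 4 * (s / 2 ^+ n).
    apply: le_trans (cabs_distD v _ _) _; have := near v vT.
    suff : cabs (segpt v w t - v) <= s / 2 ^+ n by lra.
    rewrite /segpt addrAC subrr add0r cabsM cabs_real ger0_norm //.
    by apply: le_trans (side v w vT wT); rewrite ler_piMl ?cabs_ge0.
  apply: le_trans (_ : e1 * cabs (segpt v w t - q) <= _); last by rewrite ler_pM2l.
  apply: cabs_le_eq (qr _ _) _; first by apply: le_lt_trans sq _; rewrite mulrA.
  by rewrite /err /k; ring.
have M0 : 0 <= e1 * (4 * (s / 2 ^+ n)).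
  by apply: mulr_ge0; [exact: ltW|apply: mulr_ge0; [lra|exact: s2n]].
have h : K / 4 ^+ n <= 6 * (e1 * (4 * (s / 2 ^+ n))) * (s / 2 ^+ n).
  apply: le_trans KT _; rewrite triE.
  exact: trii_le Dc errc Dx Dy Dzz M0 errM xy yz zx.
have n4 : 0 < 4 ^+ n :> R by rewrite exprn_gt0.
have n24 : 4 ^+ n = 2 ^+ n * 2 ^+ n :> R by rewrite -exprMn -natrM.
move: h; rewrite ler_pdivrMr // n24.
have -> : 6 * (e1 * (4 * (s / 2 ^+ n))) * (s / 2 ^+ n) * (2 ^+ n * 2 ^+ n) =
    e1 * (24 * s ^+ 2).
  by field; rewrite expf_neq0 // pnatr_eq0.
move=> h; apply: le_trans h _; rewrite /e1 mulrAC ler_pdivrMr // ler_pM2l //.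
by rewrite ler_pM2l //; move: s0; clear; move: s => x x0; nra.
Qed.

Lemma compact_bound (R : realType) (phi : Cplx R -> Cplx R)
    (D : set (Cplx R)) : compact D ->
  (forall z, D z -> {for z, continuous phi}) ->
  exists2 M : R, 0 <= M & forall z, D z -> cabs (phi z) <= M.
Proof.
move=> Dk pc.
have phic : {within D, continuous (fun z => cabs (phi z))}.
  apply: continuous_in_subspaceT => z; rewrite inE => Dz.
  apply: (@continuous_comp _ _ _ phi (@cabs R)); first exact: pc.
  exact: cabs_continuous.
have [M [Mr phiM]] := compact_bounded (continuous_compact phic Dk).
exists (`|M| + 1) => [|z Dz]; first by rewrite addr_ge0.
have M1 : M < `|M| + 1 by rewrite (le_lt_trans (ler_norm _)) // ltrDl.
have := phiM _ M1 (cabs (phi z)) (ex_intro2 _ _ z Dz erefl).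
by rewrite /= ger0_norm ?cabs_ge0.
Qed.

(** * Triangles with a vertex where differentiability may fail *)

Lemma ReZ (R : realType) (s : R) (x : Cplx R) :
  complex.Re (s%:C * x) = s * complex.Re x.
Proof. by rewrite ReM /= mul0r subr0. Qed.

(** For [m > 0] the half-plane omits [w], so that intersecting with it cuts from [D] a compact
    convex region away from [w]. *)
Lemma compact_halfplane (R : realType) (D : set (Cplx R)) (u w : Cplx R)
    (m : R) : compact D -> compact (D `&` [set v | m <= complex.Re (u * (v - w))]).
Proof.
move=> Dk; apply: compact_closedI => // v cv /=; rewrite leNgt; apply/negP => vm.
pose e := m - complex.Re (u * (v - w)); have e0 : 0 < e by rewrite subr_gt0.
have u1 : 0 < cabs u + 1 by rewrite ltr_wpDl ?cabs_ge0.
have /cv[x /= [mx xv]] : nbhs v [set x | cabs (x - v) < e / (cabs u + 1)].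
  by apply/cnbhsP; exists (e / (cabs u + 1)); rewrite ?divr_gt0.
have : cabs (u * (x - v)) < e.
  rewrite cabsM; move: xv; rewrite ltr_pdivlMr // mulrC.
  by apply: le_lt_trans; rewrite ler_wpM2r ?cabs_ge0 // lerDl.
have -> : u * (x - v) = u * (x - w) - u * (v - w) by ring.
move=> /(le_lt_trans (Re_le_cabs _)); rewrite ReB ltr_norml /e => /andP[_].
lra.
Qed.

Lemma cconvex_halfplane (R : realType) (D : set (Cplx R)) (u w : Cplx R)
    (m : R) : cconvex D -> cconvex (D `&` [set v | m <= complex.Re (u * (v - w))]).
Proof.
move=> Dc a b t [Da /= am] [Db /= bm] t01; split; first exact: Dc.
have -> : u * (segpt a b t - w) = (1 - t)%:C * (u * (a - w)) + t%:C * (u * (b - w)).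
  by rewrite /segpt rmorphB rmorph1; ring.
rewrite /= ReD !ReZ; move/andP : t01 => [t0 t1].
move: am bm; set x := complex.Re _; set y := complex.Re _ => xm ym; nra.
Qed.

Lemma Re_half (R : realType) (u w x : Cplx R) :
  complex.Re (u * ((x + w) / 2 - w)) = complex.Re (u * (x - w)) / 2.
Proof.
have -> : u * ((x + w) / 2 - w) = (2^-1 : R)%:C * (u * (x - w)).
  by rewrite -half_real; field.
by rewrite ReZ mulrC.
Qed.

(** The triangle and its half differ by a trapezoid, made of the triangles [a b b1] and [a b1 a1].
    Both lie in the half-plane at level [m / 2], which omits [w], so Goursat's theorem applies to
    them. *)
Lemma trii_vertex_half (R : realType) (phi : Cplx R -> Cplx R)
    (D : set (Cplx R)) (a b w u : Cplx R) (m : R) : cconvex D -> compact D ->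
  (forall z, D z -> {for z, continuous phi}) ->
  (forall z, D z -> z != w -> derivable phi z 1) ->
  D a -> D b -> D w -> 0 < m ->
  complex.Re (u * (a - w)) = m -> complex.Re (u * (b - w)) = m ->
  trii phi a b w = trii phi ((a + w) / 2) ((b + w) / 2) w.
Proof.
move=> Dc Dk pc dphi Da Db Dw m0 am bm.
have cs x y : D x -> D y -> cont_seg phi x y.
  by move=> Dx Dy; apply: cont_segP => t t01; apply: pc; exact: Dc.
have Da1 := cconvex_mid Dc Da Dw; have Db1 := cconvex_mid Dc Db Dw.
have a1m := Re_half u w a; have b1m := Re_half u w b.
move: Da1 Db1 a1m b1m; rewrite am bm.
have := segi_halves (cs b w Db Dw); have := segi_halves (cs a w Da Dw).
set a1 := (a + w) / 2; set b1 := (b + w) / 2 => Ea Eb Da1 Db1 a1m b1m.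
pose D' := D `&` [set v | m / 2 <= complex.Re (u * (v - w))].
have g x y z : D' x -> D' y -> D' z -> trii phi x y z = 0.
  apply: (goursat (cconvex_halfplane Dc) (compact_halfplane Dk)).
  move=> v [Dv /= mv]; apply: dphi => //; apply/negP => /eqP vw.
  by move: mv; rewrite vw subrr mulr0 /=; lra.
have [D'a D'b D'a1 D'b1] : [/\ D' a, D' b, D' a1 & D' b1].
  by split; split=> //=; rewrite ?am ?bm ?a1m ?b1m; lra.
have := g a b b1 D'a D'b D'b1; have := g a b1 a1 D'a D'b1 D'a1.
rewrite /trii Eb (segi_rev (cs a w Da Dw)) (segi_rev (cs a1 w Da1 Dw)) Ea.
rewrite (segi_rev (cs a b1 Da Db1)) (segi_rev (cs a1 b1 Da1 Db1)).
rewrite (segi_rev (cs a a1 Da Da1)) => h1 h2.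
apply/eqP; rewrite -subr_eq0; apply/eqP; rewrite -[RHS](addr0 0).
by rewrite -[X in _ = X + _]h1 -[X in _ = _ + X]h2; ring.
Qed.

(* Halving the triangle towards [w] keeps the integral, by Goursat's theorem away
   from [w], and makes the integral small. *)
Lemma trii_vertex (R : realType) (phi : Cplx R -> Cplx R)
    (D : set (Cplx R)) (a b w u : Cplx R) (m : R) : cconvex D -> compact D ->
  (forall z, D z -> {for z, continuous phi}) ->
  (forall z, D z -> z != w -> derivable phi z 1) ->
  D a -> D b -> D w -> 0 < m ->
  complex.Re (u * (a - w)) = m -> complex.Re (u * (b - w)) = m ->
  trii phi a b w = 0.
Proof.
move=> Dc Dk pc dphi Da Db Dw m0 am bm.
have [M M0 phiM] := compact_bound Dk pc.
have main n : forall (s : R) a b m, D a -> D b -> 0 < m ->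
    complex.Re (u * (a - w)) = m -> complex.Re (u * (b - w)) = m ->
    [/\ cabs (b - a) <= s, cabs (w - b) <= s & cabs (a - w) <= s] ->
    cabs (trii phi a b w) <= 6 * M * (s / 2 ^+ n).
  elim: n => [|n IH] s {m0 am bm}a {}b {}m {}Da {}Db m0 am bm [ab bw wa].
    rewrite expr0 divr1; apply: (trii_le Dc pc Da Db Dw M0 _ ab bw wa).
    move=> x y t xT yT t01; apply: phiM; apply: Dc => //.
      by move: xT; rewrite !inE => /or3P[]/eqP->.
    by move: yT; rewrite !inE => /or3P[]/eqP->.
  rewrite (trii_vertex_half Dc Dk pc dphi Da Db Dw m0 am bm).
  have -> : s / 2 ^+ n.+1 = s / 2 / 2 ^+ n by rewrite exprS invfM mulrA.
  apply: (IH _ _ _ (m / 2)).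
  - exact: cconvex_mid.
  - exact: cconvex_mid.
  - by rewrite divr_gt0.
  - by rewrite Re_half am.
  - by rewrite Re_half bm.
  - split.
    + by apply: (cabs_le_eq (cabs_half ab)); field.
    + by apply: (cabs_le_eq (cabs_half bw)); field.
    + by apply: (cabs_le_eq (cabs_half wa)); field.
apply/eqP; rewrite -cabs_eq0 eq_le cabs_ge0 andbT.
apply/ler_addgt0Pr => e e0; rewrite add0r.
pose s := cabs (b - a) + cabs (w - b) + cabs (a - w).
have [s1 s2 s3] : [/\ 0 <= cabs (b - a), 0 <= cabs (w - b) & 0 <= cabs (a - w)].
  by split; exact: cabs_ge0.
have [n] := half_pow_lt (6 * M * s) e0.
rewrite -mulrA => /ltW; apply: le_trans.
by apply: (main n s a b m) => //; rewrite /s; split; lra.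
Qed.

(** * Cauchy's formula on a square *)

Definition ci (R : realType) : Cplx R := 0 +i* 1.

Lemma ci2 (R : realType) : ci R * ci R = -1.
Proof. by rewrite -expr2; exact: sqr_i. Qed.

Lemma cabs_ci (R : realType) : cabs (ci R) = 1.
Proof. by rewrite /cabs /= expr0n expr1n /= add0r sqrtr1. Qed.

Lemma ci_neq0 (R : realType) : ci R != 0.
Proof. by rewrite -cabs_gt0 cabs_ci. Qed.

(** Corners of the square of centre [z] and half side [r], counterclockwise from the lower right.
    The index is a power of i, so that one computation with [i ^ k] treats all sides. *)
Definition corner (R : realType) (z : Cplx R) (r : R) (k : nat) : Cplx R :=
  z + r%:C * ((1 - ci R) * ci R ^+ k).

Definition on_square (R : realType) (z : Cplx R) (r : R) (x : Cplx R) :=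
  exists (k : nat) (t : R), 0 <= t <= 1 /\
    x = segpt (corner z r k) (corner z r k.+1) t.

Definition cont_square (R : realType) (z : Cplx R) (r : R)
    (phi : Cplx R -> Cplx R) :=
  forall x, on_square z r x -> {for x, continuous phi}.

Definition oint (R : realType) (z : Cplx R) (r : R)
    (phi : Cplx R -> Cplx R) : Cplx R :=
  \sum_(k < 4) segi phi (corner z r k) (corner z r k.+1).

(** Up to a quarter-turn every side is the right-hand one, where the real part of the factor is 1.
    This is why the square stays at distance at least [r] from [z]. *)
Lemma corner_segptE (R : realType) (z : Cplx R) (r : R) k t :
  segpt (corner z r k) (corner z r k.+1) t =
  z + r%:C * (1 + (2 * t - 1)%:C * ci R) * ci R ^+ k.
Proof.
rewrite /segpt /corner exprS rmorphB rmorphM rmorph1 rmorph_nat.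
(* The multiple of [1 + ci R * ci R], which is 0, is written out because [ring] treats [ci R] as an
   indeterminate. *)
transitivity (z + r%:C * (1 - ci R + 2 * t%:C * ci R) * ci R ^+ k
  - r%:C * t%:C * ci R ^+ k * (1 + ci R * ci R)); first by ring.
by rewrite ci2 subrr mulr0 subr0; ring.
Qed.

Lemma square_far (R : realType) (z : Cplx R) (r : R) x :
  on_square z r x -> r <= cabs (x - z).
Proof.
move=> [k [t [_ ->]]]; rewrite corner_segptE addrAC subrr add0r !cabsM cabsX.
rewrite cabs_ci expr1n mulr1 cabs_real.
apply: le_trans (ler_norm r) _; rewrite ler_peMr //.
have := Re_le_cabs (1 + (2 * t - 1)%:C * ci R).
by rewrite ReD ReZ /= mulr0 addr0 normr1.
Qed.

Lemma square_near (R : realType) (z : Cplx R) (r : R) x : 0 <= r ->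
  on_square z r x -> cabs (x - z) <= 2 * r.
Proof.
move=> r0 [k [t [t01 ->]]]; rewrite corner_segptE addrAC subrr add0r !cabsM.
rewrite cabsX cabs_ci expr1n mulr1 cabs_real ger0_norm // mulrC ler_wpM2r //.
apply: le_trans (cabsD _ _) _; rewrite cabs1 cabsM cabs_ci mulr1 cabs_real.
suff : `|2 * t - 1| <= 1 by lra.
by move/andP : t01 => [t0 t1]; rewrite ler_norml; apply/andP; split; lra.
Qed.

Lemma on_square_corner (R : realType) (z : Cplx R) (r : R) k :
  on_square z r (corner z r k).
Proof.
exists k, 0; split; first by rewrite lexx ler01.
by rewrite /segpt mul0r addr0.
Qed.

Lemma corner_side (R : realType) (z : Cplx R) (r : R) k : 0 <= r ->
  cabs (corner z r k.+1 - corner z r k) <= 4 * r.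
Proof.
move=> r0; have := square_near r0 (on_square_corner z r k).
have := square_near r0 (on_square_corner z r k.+1).
have := cabs_distD z (corner z r k.+1) (corner z r k).
by rewrite (cabsC z); lra.
Qed.

Lemma cont_square_seg (R : realType) (z : Cplx R) (r : R) phi k :
  cont_square z r phi -> cont_seg phi (corner z r k) (corner z r k.+1).
Proof.
by move=> pc; apply: cont_segP => t t01; apply: pc; exists k, t.
Qed.

Lemma corner4 (R : realType) (z : Cplx R) (r : R) : corner z r 4 = corner z r 0.
Proof.
rewrite /corner expr0 (_ : ci R ^+ 4 = 1) //.
by rewrite (_ : 4 = 2 * 2)%N // exprM !expr2 ci2 mulrNN mulr1.
Qed.

Lemma ointE (R : realType) (z : Cplx R) (r : R) phi : oint z r phi =
  segi phi (corner z r 0) (corner z r 1) + segi phi (corner z r 1) (corner z r 2)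
  + segi phi (corner z r 2) (corner z r 3) + segi phi (corner z r 3) (corner z r 0).
Proof.
by rewrite /oint !big_ord_recr big_ord0 /= add0r corner4.
Qed.

Lemma ointD (R : realType) (z : Cplx R) (r : R) phi psi :
  cont_square z r phi -> cont_square z r psi ->
  oint z r (fun x => phi x + psi x) = oint z r phi + oint z r psi.
Proof.
move=> pc qc; rewrite /oint -big_split; apply: eq_bigr => k _ /=.
by rewrite (segiD (cont_square_seg (k:=k) pc) (cont_square_seg (k:=k) qc)).
Qed.

Lemma ointM (R : realType) (z : Cplx R) (r : R) (c : Cplx R) phi :
  cont_square z r phi -> oint z r (fun x => c * phi x) = c * oint z r phi.
Proof.
move=> pc; rewrite /oint mulr_sumr; apply: eq_bigr => k _.
by rewrite (segiM _ (cont_square_seg (k:=k) pc)).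
Qed.

Lemma oint_eq (R : realType) (z : Cplx R) (r : R) phi psi :
  (forall x, on_square z r x -> phi x = psi x) ->
  oint z r phi = oint z r psi.
Proof.
move=> pq; apply: eq_bigr => k _; apply: segi_eq => t t01.
by apply: pq; exists k, t.
Qed.

(** 32 is four sides, each of length at most [4 * r] by [corner_side], times the factor 2 of
    [segi_le]. *)
Lemma oint_le (R : realType) (z : Cplx R) (r : R) phi (M : R) : 0 <= r ->
  0 <= M -> cont_square z r phi ->
  (forall x, on_square z r x -> cabs (phi x) <= M) ->
  cabs (oint z r phi) <= 32 * r * M.
Proof.
move=> r0 M0 pc pM.
have side k : cabs (segi phi (corner z r k) (corner z r k.+1)) <= 8 * r * M.
  apply: le_trans (segi_le (M := M) (cont_square_seg (k:=k) pc) _) _.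
    by move=> t t01; apply: pM; exists k, t.
  have := ler_wpM2l M0 (corner_side z k r0).
  by move: (cabs _) => x; lra.
rewrite ointE; move: (side 0%N) (side 1%N) (side 2%N) (side 3%N).
rewrite corner4.
move: (segi _ _ _) (segi _ _ _) (segi _ _ _) (segi _ _ _) => d c b a.
have := cabsD (a + b + c) d; have := cabsD (a + b) c; have := cabsD a b.
lra.
Qed.

Lemma cconvex_disk (R : realType) (z : Cplx R) (r : R) :
  cconvex [set w : Cplx R | cabs (w - z) <= r].
Proof.
move=> a b t /= ar br /andP[t0 t1].
have -> : segpt a b t - z = (1 - t)%:C * (a - z) + t%:C * (b - z).
  by rewrite /segpt rmorphB rmorph1; ring.
apply: le_trans (cabsD _ _) _; rewrite !cabsM !cabs_real !ger0_norm ?subr_ge0 //.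
have := ler_wpM2l t0 br.
have : (1 - t) * cabs (a - z) <= (1 - t) * r by rewrite ler_wpM2l // subr_ge0.
by lra.
Qed.

(** The square is cut into four triangles with common vertex [w]; each integral vanishes by
    [trii_vertex], and the spokes to [w] cancel. *)
Lemma oint_vertex (R : realType) (z : Cplx R) (r : R) phi w : 0 < r ->
  cabs (w - z) < r ->
  (forall x, cabs (x - z) <= 2 * r -> {for x, continuous phi}) ->
  (forall x, cabs (x - z) <= 2 * r -> x != w -> derivable phi x 1) ->
  oint z r phi = 0.
Proof.
move=> r0 wz pc dphi.
pose D := [set x : Cplx R | cabs (x - z) <= 2 * r].
have Dc : cconvex D := cconvex_disk (r := 2 * r).
have Dk : compact D := @compact_disk R z (2 * r).
have Dk_ k : D (corner z r k) by apply: square_near (ltW r0) (on_square_corner _ _ _).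
have Dw : D w by rewrite /D /=; lra.
have cs x y : D x -> D y -> cont_seg phi x y.
  by move=> Dx Dy; apply: cont_segP => t t01; apply: pc; exact: Dc.
have T0 k : trii phi (corner z r k) (corner z r k.+1) w = 0.
  pose u := (ci R ^+ k)^-1; have cik : ci R ^+ k != 0 by rewrite expf_neq0 // ci_neq0.
  (* Multiplying by [u] turns side [k] into the right-hand side, on which the real part is constant.
     The resulting level is positive because [w] is at distance less than [r] from [z]. *)
  apply: (@trii_vertex R phi D _ _ w u (r + complex.Re (u * (z - w)))) => //.
  - have := le_trans (Re_le_cabs (u * (z - w))) (lexx _).
    rewrite cabsM cabsV cabsX cabs_ci expr1n invr1 mul1r ler_norml => /andP[h _].
    by move: wz; rewrite cabsC; move: h; lra.
  - have -> : u * (corner z r k - w) = r%:C * (1 - ci R) + u * (z - w).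
      by rewrite /u /corner; field.
    by rewrite ReD ReZ /= subr0 mulr1.
  - have -> : u * (corner z r k.+1 - w) = r%:C * (ci R - ci R * ci R) + u * (z - w).
      by rewrite /u /corner exprS; field.
    by rewrite ci2 ReD ReZ /= add0r opprK mulr1.
pose g x := segi phi x w.
have TE k : segi phi (corner z r k) (corner z r k.+1) =
    g (corner z r k) - g (corner z r k.+1).
  have := T0 k; rewrite /trii (segi_rev (cs _ _ (Dk_ k) Dw)) -/(g _) -/(g _) => h.
  by apply/eqP; rewrite -subr_eq0 -h; apply/eqP; ring.
have := TE 3%N; rewrite corner4 => TE3.
rewrite ointE !TE TE3; move: (g _) (g _) (g _) (g _) => x0 x1 x2 x3.
by rewrite !subrKA subrr.
Qed.

(** * The Cauchy transform on the square *)

Lemma square_avoid (R : realType) (z w : Cplx R) (r : R) x :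
  cabs (w - z) < r -> on_square z r x -> x - w != 0.
Proof.
move=> wz /square_far xz; rewrite -cabs_gt0.
by have := cabs_distD w x z; lra.
Qed.

Lemma square_avoid_half (R : realType) (z w : Cplx R) (r : R) x :
  cabs (w - z) <= r / 2 -> on_square z r x -> r / 2 <= cabs (x - w).
Proof. by move=> wz /square_far xz; have := cabs_distD w x z; lra. Qed.

Lemma cont_square_inv (R : realType) (z w : Cplx R) (r : R) :
  cabs (w - z) < r -> cont_square z r (fun x => (x - w)^-1).
Proof.
move=> wz x xs; apply: ccontV; first exact: square_avoid xs.
by apply: ccontD; [exact: cvg_id|exact: ccont_cst].
Qed.

Lemma cont_squareM (R : realType) (z : Cplx R) (r : R)
    (phi psi : Cplx R -> Cplx R) :
  cont_square z r phi -> cont_square z r psi ->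
  cont_square z r (fun x => phi x * psi x).
Proof. by move=> pc qc x xs; apply: ccontM; [exact: pc|exact: qc]. Qed.

(** The Cauchy integral without its factor 1 / (2 pi i); dividing by the transform of the constant 1
    takes the place of that factor. *)
Definition ctrans (R : realType) (z : Cplx R) (r : R) (F : Cplx R -> Cplx R)
    (w : Cplx R) : Cplx R := oint z r (fun x => F x * (x - w)^-1).

(** The difference quotient of [f] at [w], with value [f' w] there, is differentiable off [w] and
    continuous at [w], which is what [oint_vertex] asks for. Its vanishing integral splits into the
    two transforms. *)
Lemma cauchy_formula (R : realType) (z w : Cplx R) (r : R)
    (f : Cplx R -> Cplx R) : 0 < r ->
  (forall x, cabs (x - z) <= 2 * r -> derivable f x 1) ->
  cabs (w - z) < r ->
  f w * ctrans z r (fun=> 1) w = ctrans z r f w.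
Proof.
move=> r0 df wz.
have w2 : cabs (w - z) <= 2 * r by lra.
have [d fd] := derivable_cdiff (df w w2).
pose phi x := if x == w then d else (f x - f w) / (x - w).
have phiE x : x != w -> phi x = (f x - f w) / (x - w).
  by rewrite /phi => /negbTE ->.
have near_neq x : x != w -> \forall y \near x, y != w.
  move=> xw; apply/cnbhsP; exists (cabs (x - w)).
    by rewrite cabs_gt0 subr_eq0.
  by move=> y yx; apply/eqP => yw; move: yx; rewrite yw cabsC ltxx.
have dphi x : cabs (x - z) <= 2 * r -> x != w -> derivable phi x 1.
  move=> xz xw.
  have : {near x, (fun y => (f y - f w) * (y - w)^-1) =1 phi}.
    by apply: filterS (near_neq x xw) => y yw; rewrite phiE.
  move=> /near_eq_derivable; apply.
  apply: derivableM.
    by apply: derivableB; [exact: df|exact: derivable_cst].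
  apply: derivableV; first by rewrite subr_eq0.
  by apply: derivableB; [exact: derivable_id|exact: derivable_cst].
have cphi x : cabs (x - z) <= 2 * r -> {for x, continuous phi}.
  move=> xz; have [->|xw] := eqVneq x w; last first.
    exact: derivable_ccontinuous (dphi x xz xw).
  apply/(@ccvgP _ _ (nbhs w)) => e e0; have e2 : 0 < e / 2 by rewrite divr_gt0.
  have [s s0 ws] := fd _ e2; apply/cnbhsP; exists s => // y yw.
  have phiw : phi w = d by rewrite /phi eqxx.
  change (cabs (phi y - phi w) < e).
  have [->|yNw] := eqVneq y w; first by rewrite subrr cabs0.
  rewrite phiw.
  rewrite phiE //; have yw0 : y - w != 0 by rewrite subr_eq0.
  have -> : (f y - f w) / (y - w) - d = (f y - f w - d * (y - w)) / (y - w).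
    by field.
  rewrite cabsM cabsV; apply: (@le_lt_trans _ _ (e / 2)); last by lra.
  by rewrite ler_pdivrMr ?cabs_gt0 //; exact: ws.
have := oint_vertex r0 wz cphi dphi.
have fc : cont_square z r f.
  by move=> x xs; apply: derivable_ccontinuous; apply: df; exact: square_near (ltW r0) xs.
have ic := cont_square_inv wz.
have cc (k : Cplx R) : cont_square z r (fun=> k) by move=> x _; exact: ccont_cst.
rewrite (@oint_eq _ _ _ _ (fun x =>
  f x * (x - w)^-1 + (- f w) * (1 * (x - w)^-1))); last first.
  move=> x xs; rewrite phiE; last by rewrite -subr_eq0 (square_avoid wz xs).
  by rewrite mulrBl mul1r mulNr.
rewrite (ointD (cont_squareM fc ic) (cont_squareM (cc _) (cont_squareM (cc _) ic))).
rewrite (ointM _ (cont_squareM (cc _) ic)) -/(ctrans z r f w).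
rewrite -/(ctrans z r (fun=> 1) w) mulNr => /eqP.
by rewrite subr_eq0 => /eqP ->.
Qed.

Lemma ctrans_le (R : realType) (z w : Cplx R) (r M : R) F : 0 < r -> 0 <= M ->
  cont_square z r F -> (forall x, on_square z r x -> cabs (F x) <= M) ->
  cabs (w - z) <= r / 2 -> cabs (ctrans z r F w) <= 64 * M.
Proof.
move=> r0 M0 Fc FM wz; have wr : cabs (w - z) < r by lra.
have -> : 64 * M = 32 * r * (M * (r / 2)^-1) by field; rewrite gt_eqF.
apply: (oint_le (ltW r0)); first by rewrite mulr_ge0 // invr_ge0; lra.
  exact: cont_squareM Fc (cont_square_inv wr).
move=> x xs; rewrite cabsM cabsV ler_pM ?cabs_ge0 ?invr_ge0 ?cabs_ge0 //.
  exact: FM.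
have h := square_avoid_half wz xs.
by rewrite lef_pV2 ?posrE //; lra.
Qed.

(** The difference of the kernels is [(w - w') / ((x - w) * (x - w'))]. Each denominator is at least
    [r / 2], so the 32 of [oint_le] becomes 128. *)
Lemma ctrans_lip (R : realType) (z w w' : Cplx R) (r M : R) F : 0 < r ->
  0 <= M ->
  cont_square z r F -> (forall x, on_square z r x -> cabs (F x) <= M) ->
  cabs (w - z) <= r / 2 -> cabs (w' - z) <= r / 2 ->
  cabs (ctrans z r F w - ctrans z r F w') <= 128 * M / r * cabs (w - w').
Proof.
move=> r0 M0 Fc FM wz wz'.
have wr : cabs (w - z) < r by lra.
have wr' : cabs (w' - z) < r by lra.
have ic := cont_square_inv wr; have ic' := cont_square_inv wr'.
have F1 := cont_squareM Fc ic; have F2 := cont_squareM Fc ic'.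
have F3 := cont_squareM F1 ic'.
have -> : ctrans z r F w - ctrans z r F w' =
    (w - w') * oint z r (fun x => F x * (x - w)^-1 * (x - w')^-1).
  apply/eqP; rewrite -(ointM _ F3) subr_eq addrC; apply/eqP.
  have cc (k : Cplx R) : cont_square z r (fun=> k) by move=> x _; exact: ccont_cst.
  rewrite -(ointD F2 (cont_squareM (cc (w - w')) F3)).
  apply: oint_eq => x xs.
  have := square_avoid wr xs; have := square_avoid wr' xs => ? ?.
  by field; apply/andP.
rewrite cabsM mulrC ler_wpM2r ?cabs_ge0 //.
have -> : 128 * M / r = 32 * r * (M * (r / 2)^-1 * (r / 2)^-1).
  by field; rewrite gt_eqF.
have rV : 0 <= (r / 2)^-1 by rewrite invr_ge0; lra.
apply: (oint_le (ltW r0)) => //; first by rewrite !mulr_ge0.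
move=> x xs; rewrite !cabsM !cabsV.
have h := square_avoid_half wz xs; have h' := square_avoid_half wz' xs.
rewrite !ler_pM ?mulr_ge0 ?invr_ge0 ?cabs_ge0 //.
- exact: FM.
- by rewrite lef_pV2 ?posrE //; lra.
- by rewrite lef_pV2 ?posrE //; lra.
Qed.

(** One step of the expansion of the kernel: 1 / (x - w) = 1 / (x - z) + (w - z) / ((x - z) (x -
    w)). *)
Lemma ctrans_step (R : realType) (z w : Cplx R) (r : R) F : 0 < r ->
  cont_square z r F -> cabs (w - z) < r ->
  ctrans z r F w =
  ctrans z r F z + (w - z) * ctrans z r (fun x => F x * (x - z)^-1) w.
Proof.
move=> r0 Fc wz; have zz : cabs (z - z) < r by rewrite subrr cabs0.
have ic := cont_square_inv wz; have iz := cont_square_inv zz.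
have F1 := cont_squareM Fc iz; have F3 := cont_squareM F1 ic.
have cc (k : Cplx R) : cont_square z r (fun=> k) by move=> x _; exact: ccont_cst.
rewrite -(ointM _ F3) -(ointD F1 (cont_squareM (cc (w - z)) F3)).
apply: oint_eq => x xs.
have := square_avoid wz xs; have := square_avoid zz xs => ? ?.
by field; apply/andP.
Qed.

(* By the symmetry of the square its four sides contribute equally, each with
   imaginary part at least 1. *)
Lemma ctrans1_neq0 (R : realType) (z : Cplx R) (r : R) : 0 < r ->
  ctrans z r (fun=> 1) z != 0.
Proof.
move=> r0; have zz : cabs (z - z) < r by rewrite subrr cabs0.
have rC : (r%:C : Cplx R) != 0 by rewrite -cabs_gt0 cabs_real normr_gt0 gt_eqF.
(* The integrand left on every side after [r] and [i ^ k] have cancelled. *)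
pose q (t : R) : Cplx R := 2 * ci R / (1 + (2 * t - 1)%:C * ci R).
have den (t : R) : 1 + (2 * t - 1)%:C * ci R != 0.
  apply/eqP => /(congr1 (@complex.Re R)).
  by rewrite ReD ReZ /= mulr0 addr0 => /eqP; rewrite oner_eq0.
have cik k : ci R ^+ k != 0 by rewrite expf_neq0 // ci_neq0.
have sideE k : segi (fun x => 1 * (x - z)^-1) (corner z r k) (corner z r k.+1) = cavg q.
  rewrite /segi -cavgM; last first.
    apply: (@cont_square_seg R z r (fun x => 1 * (x - z)^-1)).
    by apply: cont_squareM (cont_square_inv zz) => x _; exact: ccont_cst.
  apply: cavg_eq => t t01; rewrite corner_segptE /q.
  have -> : corner z r k.+1 - corner z r k =
      r%:C * (2 * ci R - (1 + ci R * ci R)) * ci R ^+ k.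
    by rewrite /corner exprS; ring.
  rewrite ci2 subrr subr0.
  have := den t; have := cik k; move: (ci R ^+ k) (1 + _) => x y x0 y0.
  by field; rewrite y0 addrAC subrr add0r !mulf_neq0.
have qc : cont01 q.
  move=> t _; apply: ccontM; first exact: ccont_cst.
  apply: ccontV; first exact: den.
  apply: ccontD; first exact: ccont_cst.
  apply: ccontM; last exact: ccont_cst.
  apply: Complex_continuous; last exact: cvg_cst.
  apply: continuousB; last exact: cvg_cst.
  by apply: continuousM; [exact: cvg_cst|exact: cvg_id].
(* With [s = 2 * t - 1], multiplying by the conjugate gives q = 2 (i + s) / (1 + s ^ 2), and |s| <=
   1 makes the imaginary part at least 1. *)
have qIm t : 0 <= t <= 1 -> 1 <= complex.Im (q t).
  move=> /andP[t0 t1]; pose s := 2 * t - 1.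
  have s1 : 0 < 1 + s ^+ 2 by rewrite ltr_pwDl // sqr_ge0.
  have s2 : (1 + s ^+ 2)%:C != 0 :> Cplx R.
    by rewrite -cabs_gt0 cabs_real normr_gt0 gt_eqF.
  have -> : q t = (2 / (1 + s ^+ 2))%:C * (ci R + s%:C).
    have E : (2 / (1 + s ^+ 2))%:C = 2 / (1 + s ^+ 2)%:C :> Cplx R.
      by rewrite fmorph_div rmorph_nat.
    have := den t; rewrite /q -/s E => dt.
    apply: (mulIf dt); rewrite divfK //; apply: (mulIf s2).
    rewrite rmorphD rmorph1 rmorphXn in s2 *.
    transitivity (2 * ci R * (1 + s%:C ^+ 2)) => //.
    have : ci R * ci R = -1 := ci2 R; move: (ci R) (s%:C) s2 => c x x2 c2.
    transitivity (2 * c * (1 + x ^+ 2) + 2 * x * (1 + c * c)).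
      by rewrite c2 subrr mulr0 addr0.
    by field.
  rewrite ImM ImD /= addr0 mulr1 mul0r addr0.
  rewrite ler_pdivlMr // mul1r /s; nra.
have q1 : 1 <= complex.Im (cavg q).
  rewrite -[leLHS]avg_cst; apply: avg_le qIm.
    by move=> t _; exact: cvg_cst.
  exact: cont01_Im.
have -> : ctrans z r (fun=> 1) z = 4%:R%:C * cavg q.
  rewrite /ctrans /oint (eq_bigr (fun=> cavg q)); last by move=> k _; exact: sideE.
  rewrite sumr_const card_ord -[LHS]mulr_natl; congr (_ * _).
  exact/esym/(rmorph_nat (real_complex R) 4).
rewrite mulf_neq0 // -?cabs_gt0 ?cabs_real ?normr_gt0 ?pnatr_eq0 //.
by apply: lt_le_trans (Im_le_cabs _); rewrite ger0_norm; lra.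
Qed.

(** * Local factorization and local inversion *)

Definition lipschitz_near (R : realType) (h : Cplx R -> Cplx R)
    (z : Cplx R) (r C : R) :=
  forall w w', cabs (w - z) < r -> cabs (w' - z) < r ->
    cabs (h w - h w') <= C * cabs (w - w').

Lemma lipschitz_near_neq0 (R : realType) (h : Cplx R -> Cplx R)
    (z : Cplx R) (r C : R) : 0 < r -> 0 <= C -> h z != 0 ->
  lipschitz_near h z r C ->
  exists s, [/\ 0 < s, s <= r & forall w, cabs (w - z) < s ->
    cabs (h z) / 2 <= cabs (h w) <= 2 * cabs (h z)].
Proof.
move=> r0 C0 hz hl; have hz0 : 0 < cabs (h z) by rewrite cabs_gt0.
have C1 : 0 < C + 1 by rewrite ltr_wpDl.
have C2 : 0 < cabs (h z) / 2 / (C + 1) by rewrite divr_gt0 // divr_gt0.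
(* Within this radius [h] moves by at most half of [cabs (h z)]; [C + 1] avoids a division by 0. *)
exists (Num.min r (cabs (h z) / 2 / (C + 1))); split.
- by rewrite lt_min r0.
- by rewrite ge_min lexx.
- move=> w; rewrite lt_min => /andP[wr ws].
  have zr : cabs (z - z) < r by rewrite subrr cabs0.
  have H : cabs (h w - h z) <= cabs (h z) / 2.
    apply: le_trans (hl w z wr zr) _.
    move: ws; rewrite ltr_pdivlMr // => /ltW; apply: le_trans.
    by rewrite mulrC ler_wpM2l ?cabs_ge0 // lerDl.
  apply/andP; split.
    by have := cabsB_ge (h z) (h w); move: H; rewrite cabsC; lra.
  have := cabsB_ge (h w) (h z); move: H; lra.
Qed.

Lemma lipschitz_near_div (R : realType) (h g : Cplx R -> Cplx R)
    (z : Cplx R) (r C C' : R) : 0 < r -> 0 <= C -> 0 <= C' ->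
  h z != 0 -> g z != 0 ->
  lipschitz_near h z r C -> lipschitz_near g z r C' ->
  exists s D, [/\ 0 < s, s <= r, 0 <= D,
    lipschitz_near (fun w => h w / g w) z s D &
    forall w, cabs (w - z) < s -> g w != 0].
Proof.
move=> r0 C0 C'0 hz gz hl gl.
have [s1 [s10 s1r hb]] := lipschitz_near_neq0 r0 C0 hz hl.
have [s2 [s20 s2r gb]] := lipschitz_near_neq0 r0 C'0 gz gl.
have Gz : 0 < cabs (g z) by rewrite cabs_gt0.
have G2 : 0 < cabs (g z) / 2 by rewrite divr_gt0.
have gn0 w : cabs (w - z) < s2 -> g w != 0.
  by move=> /gb/andP[h1 _]; rewrite -cabs_gt0; apply: lt_le_trans h1.
(* The quotient rule in finite differences: each modulus in the numerator is at most twice its value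
   at [z], and each factor of the denominator at least half of it. *)
pose D := (C * (2 * cabs (g z)) + 2 * cabs (h z) * C') /
  ((cabs (g z) / 2) * (cabs (g z) / 2)).
exists (Num.min s1 s2), D; split.
- by rewrite lt_min s10.
- by rewrite ge_min s1r.
- by rewrite /D divr_ge0 ?addr_ge0 ?mulr_ge0 ?cabs_ge0 ?invr_ge0.
- move=> w w'; rewrite !lt_min => /andP[w1 w2] /andP[w1' w2'].
  have := gn0 _ w2; have := gn0 _ w2' => gw' gw.
  have -> : h w / g w - h w' / g w' =
      ((h w - h w') * g w' - h w' * (g w - g w')) / (g w * g w').
    by field; rewrite gw gw'.
  rewrite cabsM cabsV cabsM ler_pdivrMr ?mulr_gt0 ?cabs_gt0 //.
  have [hb1 hb2] := andP (hb _ w1'); have [gb1 gb2] := andP (gb _ w2').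
  have [gb3 gb4] := andP (gb _ w2).
  apply: (@le_trans _ _ (D * cabs (w - w') *
    ((cabs (g z) / 2) * (cabs (g z) / 2)))); last first.
    rewrite ler_wpM2l //; last by rewrite ler_pM // ltW.
    by rewrite /D mulr_ge0 ?cabs_ge0 ?divr_ge0 ?addr_ge0 ?mulr_ge0 ?cabs_ge0 ?invr_ge0.
  rewrite /D mulrAC divfK; last by rewrite mulf_neq0 // gt_eqF.
  apply: le_trans (cabsD _ _) _; rewrite cabsN !cabsM mulrDl lerD //.
    rewrite mulrAC ler_pM ?mulr_ge0 ?cabs_ge0 //.
    by apply: hl; [move: w1|move: w1']; move/lt_le_trans; apply.
  rewrite -[leRHS]mulrA ler_pM ?mulr_ge0 ?cabs_ge0 //.
  by apply: gl; [move: w2|move: w2']; move/lt_le_trans; apply.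
- by move=> w; rewrite lt_min => /andP[_]; exact: gn0.
Qed.

(** Each division by [x - z] costs at most a factor [1 / r] on the square. The transforms of these
    integrands at [z] serve as Taylor coefficients. *)
Lemma iter_div_bound (R : realType) (z : Cplx R) (r M : R)
    (F : nat -> Cplx R -> Cplx R) : 0 < r -> 0 <= M ->
  (forall j, F j.+1 = fun x => F j x * (x - z)^-1) ->
  (forall x, on_square z r x -> cabs (F 0%N x) <= M) ->
  cont_square z r (F 0%N) ->
  (forall j, cont_square z r (F j)) /\
  (forall j x, on_square z r x -> cabs (F j x) <= M / r ^+ j).
Proof.
move=> r0 M0 FS FM Fc; have zz : cabs (z - z) < r by rewrite subrr cabs0.
split.
  elim=> [//|j IH]; rewrite FS.
  exact: cont_squareM IH (cont_square_inv zz).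
elim=> [|j IH] x xs; first by rewrite expr0 divr1; exact: FM.
rewrite FS cabsM cabsV exprSr invfM mulrA ler_pM ?cabs_ge0 ?invr_ge0 ?cabs_ge0 //.
  exact: IH.
have := square_far xs => xr; rewrite lef_pV2 ?posrE //; exact: lt_le_trans xr.
Qed.

(** If all the coefficients at [z] vanish, the remainders of the expansion force [f = 0] near [z].
    Otherwise the first nonzero one gives the order [k], and [h] is the transform of [F k] divided
    by that of 1. *)
Theorem local_factor (R : realType) (f : Cplx R -> Cplx R) (z : Cplx R)
    (r0 : R) : 0 < r0 ->
  (forall w, cabs (w - z) < r0 -> derivable f w 1) ->
  (exists2 r, 0 < r & forall w, cabs (w - z) < r -> f w = 0) \/
  (exists k h r C, [/\ 0 < r, r <= r0, 0 <= C, h z != 0 & lipschitz_near h z r C] /\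
     forall w, cabs (w - z) < r -> f w = (w - z) ^+ k * h w).
Proof.
(* With [r0 / 3], the disk of radius [2 * r], which contains the square, lies in the domain where
   [f] is differentiable. *)
move=> r00 df; pose r := r0 / 3; have r0' : 0 < r by rewrite divr_gt0.
have df2 x : cabs (x - z) <= 2 * r -> derivable f x 1.
  by move=> xr; apply: df; apply: le_lt_trans xr _; rewrite /r; lra.
have fc2 x : cabs (x - z) <= 2 * r -> {for x, continuous f}.
  by move=> /df2; exact: derivable_ccontinuous.
have [M M0 fM] := compact_bound (@compact_disk R z (2 * r)) fc2.
have fc : cont_square z r f.
  by move=> x xs; apply: fc2; exact: square_near (ltW r0') xs.
have fM' x : on_square z r x -> cabs (f x) <= M.
  by move=> xs; apply: fM; exact: square_near (ltW r0') xs.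
pose F j := iter j (fun g x => g x * (x - z)^-1) f.
have [Fc FM] := @iter_div_bound R z r M F r0' M0 (fun=> erefl) fM' fc.
pose K w := ctrans z r (fun=> 1) w.
have Kz : K z != 0 by exact: ctrans1_neq0.
have K1 : cont_square z r (fun=> 1 : Cplx R) by move=> x _; exact: ccont_cst.
have Kl : lipschitz_near K z (r / 2) (128 * 1 / r).
  move=> w w' /ltW wz /ltW wz'; apply: ctrans_lip => //.
  by move=> x _; rewrite cabs1.
have Kl0 : 0 <= 128 * 1 / r by rewrite divr_ge0 ?mulr1 // ltW.
have Fz j w : (forall i, (i < j)%N -> ctrans z r (F i) z = 0) ->
    cabs (w - z) < r -> ctrans z r f w = (w - z) ^+ j * ctrans z r (F j) w.
  move=> + wz; elim: j => [|j IH] Fj; first by rewrite mul1r.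
  rewrite IH; last by move=> i ij; apply: Fj; rewrite ltnW.
  by rewrite (ctrans_step r0' (Fc j) wz) Fj // add0r exprSr mulrA.
have [allz|] := pselect (forall j, ctrans z r (F j) z = 0).
  left; have r2 : 0 < r / 2 by rewrite divr_gt0.
  have [s [s0 sr Ks]] := lipschitz_near_neq0 r2 Kl0 Kz Kl.
  exists s => // w ws.
  have wr2 : cabs (w - z) < r / 2 by apply: lt_le_trans sr.
  have wr : cabs (w - z) < r by lra.
  have Kw : K w != 0.
    have /andP[h _] := Ks w ws; rewrite -cabs_gt0; apply: lt_le_trans h.
    by rewrite divr_gt0 // cabs_gt0.
  apply: (mulIf Kw); rewrite mul0r (cauchy_formula r0' df2 wr).
  apply/eqP; rewrite -cabs_eq0 eq_le cabs_ge0 andbT.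
  apply/ler_addgt0Pr => e e0; rewrite add0r.
  (* The power of [w - z] is at most [(r / 2) ^ n] and the transform at most [64 * M / r ^ n], so
     the product is at most [64 * M / 2 ^ n]. *)
  have [n] := half_pow_lt (64 * M) e0; move=> /ltW; apply: le_trans.
  rewrite (@Fz n w) //.
  rewrite cabsM cabsX.
  have h1 : cabs (ctrans z r (F n) w) <= 64 * (M / r ^+ n).
    apply: (ctrans_le r0' _ (Fc n) (FM n) (ltW wr2)).
    by rewrite divr_ge0 // exprn_ge0 // ltW.
  have h2 : cabs (w - z) ^+ n <= (r / 2) ^+ n.
    by rewrite lerXn2r ?nnegrE ?cabs_ge0 // ltW.
  apply: le_trans (ler_pM _ _ h2 h1) _; rewrite ?exprn_ge0 ?cabs_ge0 //.
  rewrite exprMn exprVn le_eqVlt; apply/orP; left; apply/eqP.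
  by field; rewrite !expf_neq0 // ?pnatr_eq0 // gt_eqF.
move=> /existsNP[j0 /eqP j0z]; right.
have ex : exists j, ctrans z r (F j) z != 0 by exists j0.
have [k kz kmin] := ex_minnP ex.
have Fl : lipschitz_near (ctrans z r (F k)) z (r / 2) (128 * (M / r ^+ k) / r).
  move=> w w' /ltW wz /ltW wz'; apply: (ctrans_lip r0' _ (Fc k) (FM k) wz wz').
  by rewrite divr_ge0 // exprn_ge0 // ltW.
have r2 : 0 < r / 2 by rewrite divr_gt0.
have FC0 : 0 <= 128 * (M / r ^+ k) / r.
  have rk : 0 <= r ^+ k by rewrite exprn_ge0 // ltW.
  by apply: divr_ge0 (ltW r0'); apply: mulr_ge0 => //; exact: divr_ge0.
have [s [C [s0 sr C0 hl gn0]]] := lipschitz_near_div r2 FC0 Kl0 kz Kz Fl Kl.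
exists k, (fun w => ctrans z r (F k) w / K w), s, C; split.
  split=> //; first by rewrite /r in sr; lra.
  by rewrite mulf_neq0 // invr_eq0.
move=> w ws; have wr : cabs (w - z) < r by lra.
apply: (mulIf (gn0 w ws)); rewrite (cauchy_formula r0' df2 wr).
rewrite (@Fz k w) //; first by rewrite -mulrA divfK // gn0.
move=> i ik; apply/eqP/negPn/negP => /kmin; by rewrite leqNgt ik.
Qed.

(** A two-point form of differentiability: [phi] minus its linear part is [e]-Lipschitz. For
    [e = cabs c / 2] it yields injectivity and openness. *)
Definition near_linear (R : realType) (phi : Cplx R -> Cplx R) (z : Cplx R)
    (r : R) (c : Cplx R) (e : R) :=
  forall w w', cabs (w - z) < r -> cabs (w' - z) < r ->
    cabs (phi w - phi w' - c * (w - w')) <= e * cabs (w - w').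

Lemma near_linear_inj (R : realType) (phi : Cplx R -> Cplx R) (z c : Cplx R)
    (r : R) w w' : near_linear phi z r c (cabs c / 2) ->
  cabs (w - z) < r -> cabs (w' - z) < r ->
  cabs c / 2 * cabs (w - w') <= cabs (phi w - phi w').
Proof.
move=> nl wr wr'; have := nl _ _ wr wr'.
have := cabsB_ge (c * (w - w')) (phi w - phi w').
by rewrite (cabsC (c * _)) cabsM; lra.
Qed.

Lemma near_linear_cont (R : realType) (phi : Cplx R -> Cplx R) (z c : Cplx R)
    (r e : R) w : 0 <= e -> near_linear phi z r c e ->
  cabs (w - z) < r -> {for w, continuous phi}.
Proof.
move=> e0 nl wr; apply/(@ccvgP _ _ (nbhs w)) => d d0.
have c1 : 0 < cabs c + e + 1 by rewrite ltr_wpDl // addr_ge0 ?cabs_ge0.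
apply/cnbhsP; exists (Num.min (r - cabs (w - z)) (d / (cabs c + e + 1))).
  by rewrite lt_min subr_gt0 wr divr_gt0.
move=> x; rewrite lt_min => /andP[xr].
rewrite ltr_pdivlMr // => xd.
have xz : cabs (x - z) < r by have := cabs_distD w x z; lra.
apply: le_lt_trans xd; have := nl _ _ xz wr.
have := cabsD (phi x - phi w - c * (x - w)) (c * (x - w)).
rewrite subrK cabsM => h1 h2.
change (cabs (phi x - phi w) <= cabs (x - w) * (cabs c + e + 1)).
by have := cabs_ge0 (x - w); lra.
Qed.

(** Take [w] minimizing the distance from [phi w] to [y] on the closed disk of radius [r / 2]. On
    its boundary [phi] is at least [cabs c * r / 4] away from [phi z], so the minimum is interior.
    If it were nonzero, a short Newton step towards [y] would decrease it. *)
Lemma near_linear_surj (R : realType) (phi : Cplx R -> Cplx R) (z c y : Cplx R)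
    (r : R) : 0 < r -> c != 0 -> near_linear phi z r c (cabs c / 2) ->
  cabs (y - phi z) < cabs c * r / 8 ->
  exists2 w, cabs (w - z) < r / 2 & phi w = y.
Proof.
move=> r0 c0 nl yz; have C0 : 0 < cabs c by rewrite cabs_gt0.
pose D := [set w : Cplx R | cabs (w - z) <= r / 2].
have Dr w : D w -> cabs (w - z) < r by rewrite /D /=; lra.
have phic : {within D, continuous (fun w => cabs (phi w - y))}.
  apply: continuous_in_subspaceT => w; rewrite inE => Dw.
  apply: (@continuous_comp _ _ _ (fun w => phi w - y) (@cabs R)); last exact: cabs_continuous.
  apply: ccontD; last exact: ccont_cst.
  by apply: near_linear_cont nl (Dr _ Dw); rewrite divr_ge0 ?cabs_ge0.
have zz : cabs (z - z) < r by rewrite subrr cabs0.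
have Dz : D z by rewrite /D /= subrr cabs0; lra.
have [||w] := compact_EVT_min _ _ phic; first by exists z.
  exact: compact_disk.
rewrite inE => Dw wmin.
have minz : cabs (phi w - y) < cabs c * r / 8.
  by rewrite (le_lt_trans (wmin z _)) ?inE // cabsC.
have wr2 : cabs (w - z) < r / 2.
  rewrite lt_neqAle andbC; apply/andP; split; first exact: Dw.
  apply/eqP => wE; have := near_linear_inj nl (Dr _ Dw) zz; rewrite wE.
  have := cabs_distD y (phi w) (phi z).
  by have := mulr_gt0 C0 r0; lra.
exists w => //; apply/eqP; apply/negPn/negP => wy.
pose v := y - phi w; have v0 : 0 < cabs v by rewrite cabs_gt0 subr_eq0 eq_sym.
(* The second bound keeps the step in the disk. A step of fraction [t] leaves at most
   [1 - t + t / 2] of the distance. *)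
pose t := Num.min 1 ((r / 2 - cabs (w - z)) * cabs c / cabs v).
have t0 : 0 < t by rewrite /t lt_min ltr01 divr_gt0 // mulr_gt0 // subr_gt0.
have t1 : t <= 1 by rewrite /t ge_min lexx.
pose w' := w + t%:C * v / c.
have w'w : w' - w = t%:C * v / c by rewrite /w' addrAC subrr add0r.
have w'a : cabs (w' - w) = t * cabs v / cabs c.
  by rewrite w'w !cabsM cabsV cabs_real gtr0_norm.
have Dw' : D w'.
  rewrite /D /=; apply: le_trans (cabs_distD w _ _) _.
  rewrite w'a -lerBrDr ler_pdivrMr // -ler_pdivlMr //.
  by rewrite /t ge_min lexx orbT.
have := wmin w'; rewrite inE => /(_ Dw').
have := nl _ _ (Dr _ Dw') (Dr _ Dw).
rewrite w'a w'w (_ : c * (t%:C * v / c) = t%:C * v); last by field.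
rewrite (_ : cabs c / 2 * (t * cabs v / cabs c) = t * cabs v / 2); last first.
  by field; rewrite gt_eqF.
have -> : phi w - y = - v by rewrite opprB.
have := cabsD (phi w' - phi w - t%:C * v) (- ((1 - t)%:C * v)).
have -> : phi w' - phi w - t%:C * v + - ((1 - t)%:C * v) = phi w' - y.
  by rewrite rmorphB rmorph1 /v; ring.
rewrite !cabsN cabsM cabs_real ger0_norm ?subr_ge0 //.
by have := mulr_gt0 t0 v0; lra.
Qed.

(** Induction on [k] by the product rule; [e1], [D] and the bound 1 on the radius keep each of the
    three error terms below [e / 3]. *)
Lemma expr_near_linear (R : realType) (a : Cplx R) (k : nat) (e : R) : 0 < e ->
  exists2 r, 0 < r & near_linear (fun x => x ^+ k) a r (k%:R * a ^+ k.-1) e.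
Proof.
elim: k e => [|k IH] e e0.
  exists 1 => // w w' _ _.
  by rewrite !expr0 subrr mul0r mul0r subrr cabs0 mulr_ge0 ?cabs_ge0 // ltW.
pose d : Cplx R := k%:R * a ^+ k.-1.
pose e1 := e / (3 * (cabs a + 1)).
have a1 : 0 < cabs a + 1 by rewrite ltr_wpDl ?cabs_ge0.
have e10 : 0 < e1 by rewrite divr_gt0 // mulr_gt0.
have [r r0 nl] := IH e1 e10.
pose D := 3 * (cabs d + e1 + 1).
have D0 : 0 < D by rewrite /D mulr_gt0 // ltr_wpDl // addr_ge0 ?cabs_ge0 // ltW.
exists (Num.min 1 (Num.min r (e / D))); first by rewrite !lt_min ltr01 r0 divr_gt0.
move=> x y; rewrite !lt_min => /and3P[x1 xr xe] /and3P[y1 yr ye].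
have aa : cabs (a - a) < r by rewrite subrr cabs0.
have -> : k.+1%:R * a ^+ k.+1.-1 = a * d + a ^+ k.
  rewrite /d mulrCA -natr1 mulrDl mul1r /=; congr (_ + _).
  by case: (k) => [|m]; rewrite ?mul0r //= exprS.
rewrite !exprS.
have -> : x * x ^+ k - y * y ^+ k - (a * d + a ^+ k) * (x - y) =
    x * (x ^+ k - y ^+ k - d * (x - y)) + (x - a) * d * (x - y) +
    (y ^+ k - a ^+ k) * (x - y) by ring.
have xa : cabs x <= cabs a + 1 by have := cabsB_ge x a; lra.
have h1 := nl _ _ xr yr; have h2 := nl _ _ yr aa.
have h3 : cabs (y ^+ k - a ^+ k) <= (cabs d + e1) * cabs (y - a).
  have := cabsD (y ^+ k - a ^+ k - d * (y - a)) (d * (y - a)).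
  by rewrite subrK cabsM; move: h2; rewrite -/d; lra.
have ye3 : (cabs d + e1) * cabs (y - a) <= e / 3.
  move: ye; rewrite ltr_pdivlMr // /D => ye.
  by have := cabs_ge0 (y - a); lra.
have xe3 : cabs (x - a) * cabs d <= e / 3.
  move: xe; rewrite ltr_pdivlMr // /D => xe.
  have := cabs_ge0 (x - a) => xa0; have := mulr_ge0 xa0 (ltW e10); lra.
have xe4 : cabs x * e1 <= e / 3.
  apply: le_trans (_ : (cabs a + 1) * e1 <= _); first by rewrite ler_wpM2r // ltW.
  rewrite /e1 le_eqVlt; apply/orP; left; apply/eqP; field.
  by rewrite gt_eqF // gt_eqF.
have := cabsD (x * (x ^+ k - y ^+ k - d * (x - y)) + (x - a) * d * (x - y))
    ((y ^+ k - a ^+ k) * (x - y)).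
have := cabsD (x * (x ^+ k - y ^+ k - d * (x - y))) ((x - a) * d * (x - y)).
rewrite -/d in h1; clearbody d; rewrite !cabsM; set X := cabs (x - y).
have X0 : 0 <= X by exact: cabs_ge0.
have := ler_wpM2r X0 xe4; have := ler_wpM2r X0 xe3.
have := ler_wpM2r X0 (le_trans h3 ye3).
have := ler_wpM2l (cabs_ge0 x) h1; rewrite -/X.
lra.
Qed.

(** The root is a local inverse of [x ^ k] at a chosen root [a] of [h z]; the derivative there is
    nonzero because [a] is. *)
Lemma lipschitz_root (R : realType) (h : Cplx R -> Cplx R) (z : Cplx R)
    (r C : R) (k : nat) : (0 < k)%N -> 0 < r -> 0 <= C -> h z != 0 ->
  lipschitz_near h z r C ->
  exists rho s D, [/\ 0 < s, s <= r, 0 <= D, lipschitz_near rho z s D &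
    forall w, cabs (w - z) < s -> rho w ^+ k = h w].
Proof.
move=> k0 r0 C0 hz hl; pose a := k.-root (h z).
have ak : a ^+ k = h z by rewrite rootCK.
have a0 : a != 0 by apply: contra_neq hz => a0; rewrite -ak a0 expr0n gtn_eqF.
pose c : Cplx R := k%:R * a ^+ k.-1.
have c0 : c != 0 by rewrite mulf_neq0 ?expf_neq0 // pnatr_eq0 -lt0n.
have C0' : 0 < cabs c by rewrite cabs_gt0.
have C2 : 0 < cabs c / 2 by rewrite divr_gt0.
have [q q0 nl] := expr_near_linear a k C2.
(* Requiring [x] to be close to [a] fixes the branch: on that disk [near_linear_inj] bounds
   distances of roots by distances of their powers. *)
have ex y : exists x, cabs (y - h z) < cabs c * q / 8 ->
    cabs (x - a) < q /\ x ^+ k = y.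
  have [yz|yz] := pselect (cabs (y - h z) < cabs c * q / 8); last by exists 0.
  rewrite -ak in yz; have [x xq xk] := near_linear_surj q0 c0 nl yz.
  by exists x => _; split=> //; lra.
have [sg sgP] := choice ex.
have Q0 : 0 < cabs c * q / 8 by rewrite divr_gt0 // mulr_gt0.
have C1 : 0 < C + 1 by rewrite ltr_wpDl.
pose s := Num.min r (cabs c * q / 8 / (C + 1)).
have zr : cabs (z - z) < r by rewrite subrr cabs0.
have hs w : cabs (w - z) < s -> cabs (h w - h z) < cabs c * q / 8.
  rewrite lt_min => /andP[wr ws]; apply: le_lt_trans (hl _ _ wr zr) _.
  move: ws; rewrite ltr_pdivlMr //; apply: le_lt_trans.
  by rewrite mulrC ler_wpM2l ?cabs_ge0 // lerDl.
exists (fun w => sg (h w)), s, (C / (cabs c / 2)); split.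
- by rewrite lt_min r0 divr_gt0.
- by rewrite ge_min lexx.
- by rewrite divr_ge0 // ltW.
- move=> w w' ws ws'.
  have [E1 E2] := sgP _ (hs _ ws); have [E1' E2'] := sgP _ (hs _ ws').
  have := near_linear_inj nl E1 E1'; rewrite E2 E2' => h1.
  rewrite mulrAC ler_pdivlMr // mulrC; apply: le_trans h1 _; apply: hl.
    by move: ws; rewrite lt_min => /andP[].
  by move: ws'; rewrite lt_min => /andP[].
- by move=> w /hs/sgP[].
Qed.

(** [phi] is [w - z] times a k-th root [rho] of [h]. The vanishing factor [w - z] offsets the mere
    Lipschitz regularity of [rho]. *)
Theorem local_normal_form (R : realType) (f : Cplx R -> Cplx R) (z : Cplx R)
    (r0 : R) : 0 < r0 -> f z = 0 ->
  (forall w, cabs (w - z) < r0 -> derivable f w 1) ->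
  (exists2 r, 0 < r & forall w, cabs (w - z) < r -> f w = 0) \/
  (exists k phi r c, [/\ (0 < k)%N, 0 < r, r <= r0, c != 0 & phi z = 0] /\
     near_linear phi z r c (cabs c / 2) /\
     forall w, cabs (w - z) < r -> f w = phi w ^+ k).
Proof.
move=> r00 fz df; have [|] := local_factor r00 df; first by left.
move=> [k [h [r [C [[r1 rr0 C0 hz hl] fE]]]]]; right.
have zr : cabs (z - z) < r by rewrite subrr cabs0.
have k0 : (0 < k)%N.
  rewrite lt0n; apply/eqP => k0; move: (fE z zr); rewrite fz k0 mul1r => E.
  by move: hz; rewrite -E eqxx.
have [rho [s [D [s0 sr D0 rl rE]]]] := lipschitz_root k0 r1 C0 hz hl.
pose c := rho z; have zs : cabs (z - z) < s by rewrite subrr cabs0.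
have c0 : c != 0.
  apply: contra_neq hz => E; rewrite -(rE z zs) -/c E expr0n.
  by rewrite gtn_eqF.
have C0' : 0 < cabs c by rewrite cabs_gt0.
have D1 : 0 < 4 * (D + 1) by rewrite mulr_gt0 // ltr_wpDl.
(* The radius makes each of the two error terms at most [cabs c / 4] times the distance of [w] and
   [w']. *)
exists k, (fun w => (w - z) * rho w), (Num.min s (cabs c / (4 * (D + 1)))), c.
split.
  split=> //; last by rewrite subrr mul0r.
    by rewrite lt_min s0 divr_gt0.
  by rewrite ge_min (le_trans sr).
split; last first.
  move=> w; rewrite lt_min => /andP[ws _].
  by rewrite fE ?(lt_le_trans ws) // exprMn rE.
move=> w w'; rewrite !lt_min !ltr_pdivlMr // => /andP[ws wc] /andP[ws' wc'].
have -> : (w - z) * rho w - (w' - z) * rho w' - c * (w - w') =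
    (rho w - rho z) * (w - w') + (w' - z) * (rho w - rho w').
  by rewrite /c; ring.
have h1 := rl _ _ ws zs; have h2 := rl _ _ ws ws'.
have := cabsD ((rho w - rho z) * (w - w')) ((w' - z) * (rho w - rho w')).
rewrite !cabsM; set X := cabs (w - w') in h2 *.
have X0 : 0 <= X by exact: cabs_ge0.
have := ler_wpM2l (cabs_ge0 (w' - z)) h2; have := ler_wpM2r X0 h1.
have wD : D * cabs (w - z) <= cabs c / 4.
  by have := cabs_ge0 (w - z); lra.
have wD' : cabs (w' - z) * D <= cabs c / 4.
  by have := cabs_ge0 (w' - z); lra.
have := ler_wpM2r X0 wD; have := ler_wpM2r X0 wD'.
lra.
Qed.

(** * Stars of arcs *)

(** [arc_open] asks that the arc without its ends be open relative to [E]; this is what makes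
    overlapping arcs comparable. *)
Record arc_in (R : realType) (E : set (Cplx R)) (g : R -> Cplx R) : Prop :=
  ArcIn {
  arc_cont : cont01 g;
  arc_inj : {in `[0, 1] &, injective g};
  arc_sub : g @` `[0, 1] `<=` E;
  arc_open : exists2 O, open O & E `&` O = g @` `]0, 1[
}.

Lemma arc_compact (R : realType) (g : R -> Cplx R) :
  cont01 g -> compact (g @` `[0, 1]).
Proof.
by move=> gc; apply: continuous_compact (cont01_within gc) (@segment_compact _ 0 1).
Qed.

Lemma finite_roots (R : realType) (m : nat) : (0 < m)%N ->
  finite_set [set x : Cplx R | x ^+ m = -1].
Proof.
move=> m0; pose p : {poly Cplx R} := 'X^m + 1.
have [s ps] := closed_field_poly_normal p.
apply: (sub_finite_set _ (finite_seq s)) => x /= xm.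
have px : root p x by rewrite /root !hornerE xm addNr.
have p0 : p != 0.
  by apply: monic_neq0; rewrite monicE /p lead_coefDl ?lead_coefXn //
    size_polyXn size_polyC oner_eq0 ltnS.
move: px; rewrite ps rootZ ?lead_coef_eq0 //.
by rewrite root_prod_XsubC.
Qed.

(** [x ^ k] is a square root of -1, hence purely imaginary. *)
Lemma Re_pow_root (R : realType) (x : Cplx R) (k : nat) :
  x ^+ (2 * k) = -1 -> complex.Re (x ^+ k) = 0.
Proof.
rewrite mulnC exprM; move: (x ^+ k) => y; rewrite expr2 => y2.
have := congr1 (@complex.Im R) y2; have := congr1 (@complex.Re R) y2.
rewrite ReM ImM /=; move: (complex.Re y) (complex.Im y) => a b h1 h2.
apply/eqP/negPn/negP => a0; move: h1.
have /eqP : a * (2 * b) = 0 by rewrite oppr0 in h2; lra.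
rewrite mulf_eq0 (negbTE a0) mulf_eq0 pnatr_eq0 /= => /eqP ->.
have := sqr_ge0 a; rewrite expr2; lra.
Qed.

Lemma root_of_Re_pow (R : realType) (y : Cplx R) (k : nat) :
  y != 0 -> complex.Re (y ^+ k) = 0 ->
  (y / (cabs y)%:C) ^+ (2 * k) = -1.
Proof.
move=> y0 yk; pose b := complex.Im (y ^+ k).
have yE : y ^+ k = b%:C * ci R.
  by apply: complex_eq; rewrite ?ReM ?ImM /= ?yk ?mulr0 ?mul0r ?mulr1 ?subrr ?addr0.
have b0 : (b ^+ 2)%:C != 0 :> Cplx R.
  rewrite -cabs_gt0 cabs_real normr_gt0 expf_neq0 //.
  by apply: contra_neq (expf_neq0 k y0) => b0; rewrite yE b0 mul0r.
have e1 : y ^+ (2 * k) = - (b ^+ 2)%:C.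
  rewrite mulnC exprM yE exprMn (expr2 (ci R)) ci2 mulrN1.
  by rewrite rmorphXn.
have e2 : (cabs y)%:C ^+ (2 * k) = (b ^+ 2)%:C :> Cplx R.
  by rewrite -rmorphXn mulnC exprM -cabsX cabs_def yk expr0n add0r.
by rewrite exprMn exprVn e1 e2 mulNr divff.
Qed.

Lemma cabs_root1 (R : realType) (x : Cplx R) (m : nat) : (0 < m)%N ->
  x ^+ m = -1 -> cabs x = 1.
Proof.
move=> m0 /(congr1 (@cabs R)); rewrite cabsX cabsN cabs1 => /eqP.
by rewrite pexpr_eq1 ?cabs_ge0 // => /eqP.
Qed.

(* Near [z], the zero set of Re (phi ^ k) is the preimage under [phi] of the
   2k rays through the roots of x ^ (2k) = -1. *)
Lemma star (R : realType) (E : set (Cplx R)) (phi : Cplx R -> Cplx R)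
    (z c : Cplx R) (r : R) (k : nat) : (0 < k)%N -> 0 < r -> c != 0 ->
  phi z = 0 -> near_linear phi z r c (cabs c / 2) ->
  (forall w, cabs (w - z) < r -> E w <-> complex.Re (phi w ^+ k) = 0) ->
  exists (A : set (R -> Cplx R)) (s : R), [/\ finite_set A, 0 < s,
    forall g, A g -> arc_in E g /\ g 0 = z &
    forall w, E w -> cabs (w - z) < s -> exists2 g, A g & (g @` `[0, 1]) w].
Proof.
move=> k0 r0 c0 phiz nl EP.
have C0 : 0 < cabs c by rewrite cabs_gt0.
have C2 : 0 <= cabs c / 2 by rewrite divr_ge0 // ltW.
pose q := cabs c * r / 8; have q0 : 0 < q by rewrite divr_gt0 // mulr_gt0.
(* [psi] will be the inverse of [phi] on the disk of radius [q]; outside it the value [z] is a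
   dummy. *)
have ex y : exists x, cabs y < q -> cabs (x - z) < r / 2 /\ phi x = y.
  have [yq|yq] := pselect (cabs y < q); last by exists z.
  have [|x xr xy] := @near_linear_surj _ phi z c y r r0 c0 nl.
    by rewrite phiz subr0.
  by exists x.
have [psi psiP] := choice ex.
have psir y : cabs y < q -> cabs (psi y - z) < r.
  by move=> /psiP[+ _]; lra.
have phi_inj w w' : cabs (w - z) < r -> cabs (w' - z) < r -> phi w = phi w' ->
    w = w'.
  move=> wr wr' ww'; have := near_linear_inj nl wr wr'.
  rewrite ww' subrr cabs0 => h; apply/eqP; rewrite -subr_eq0 -cabs_eq0.
  rewrite eq_le cabs_ge0 andbT.
  have : 0 < cabs c / 2 by rewrite divr_gt0.
  by move=> /(pmulr_rle0 _) <-.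
have zz : cabs (z - z) < r by rewrite subrr cabs0.
have psi0 : psi 0 = z.
  by apply: phi_inj => //; [apply: psir; rewrite cabs0|rewrite (psiP 0 _).2 ?cabs0].
have psic y : cabs y < q -> {for y, continuous psi}.
  move=> yq; apply/(@ccvgP _ _ (nbhs y)) => e e0.
  apply/cnbhsP; exists (Num.min (q - cabs y) (cabs c / 2 * e)).
    by rewrite lt_min subr_gt0 yq mulr_gt0 // divr_gt0.
  move=> x; rewrite lt_min => /andP[xy xe].
  have xq : cabs x < q by have := cabsB_ge x y; lra.
  change (cabs (psi x - psi y) < e).
  have := near_linear_inj nl (psir _ xq) (psir _ yq).
  rewrite (psiP _ xq).2 (psiP _ yq).2 => h.
  by rewrite -(ltr_pM2l (_ : 0 < cabs c / 2)) ?divr_gt0 //; lra.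
(* The rays are cut at length [q / 2], so that the far ends at [t = 1] still lie in the domain of
   [psi]. *)
pose s1 := q / 2; have s10 : 0 < s1 by rewrite divr_gt0.
pose Om := [set x : Cplx R | x ^+ (2 * k) = -1].
have k20 : (0 < 2 * k)%N by rewrite muln_gt0.
have Omf : finite_set Om := finite_roots R k20.
have Om1 x : Om x -> cabs x = 1 by exact: cabs_root1.
pose pt (x : Cplx R) (t : R) : Cplx R := (t * s1)%:C * x.
have ptq x (t : R) : Om x -> 0 <= t <= 1 -> cabs (pt x t) < q.
  move=> /Om1 x1 /andP[t0 t1]; rewrite cabsM x1 mulr1 cabs_real ger0_norm.
    by rewrite /s1; nra.
  by rewrite mulr_ge0 // ltW.
pose gam (x : Cplx R) (t : R) := psi (pt x t).
have phigam x (t : R) : Om x -> 0 <= t <= 1 -> phi (gam x t) = pt x t.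
  by move=> xO t01; rewrite (psiP _ (ptq x t xO t01)).2.
have gamr x (t : R) : Om x -> 0 <= t <= 1 -> cabs (gam x t - z) < r.
  by move=> xO t01; exact: psir (ptq x t xO t01).
have gamc x : Om x -> cont01 (gam x).
  move=> xO t t01; apply: (@continuous_comp _ _ _ (pt x) psi).
    apply: ccontM; last exact: ccont_cst.
    apply: Complex_continuous; last exact: cvg_cst.
    by apply: (@cvgM _ _ _ _ (fun x => x) (fun=> s1)); [exact: cvg_id|exact: cvg_cst].
  by apply: psic; exact: ptq.
have pt_inj x x' (t t' : R) : Om x -> Om x' -> 0 <= t <= 1 -> 0 <= t' <= 1 ->
    pt x t = pt x' t' -> t = t' /\ (t != 0 -> x = x').
  move=> xO xO' /andP[t0 t1] /andP[t0' t1'] E1.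
  have tt' : t = t'.
    have := congr1 (@cabs R) E1; rewrite !cabsM (Om1 x xO) (Om1 x' xO') !mulr1 !cabs_real.
    rewrite (ger0_norm (mulr_ge0 t0 (ltW s10))) (ger0_norm (mulr_ge0 t0' (ltW s10))) => /eqP.
    by rewrite -subr_eq0 -mulrBl mulf_eq0 (gt_eqF s10) orbF subr_eq0 => /eqP.
  split=> // tn0; move: E1; rewrite /pt -tt'; apply: mulfI.
  by rewrite -cabs_gt0 cabs_real normr_gt0 mulf_neq0 // gt_eqF.
have gam_inj x x' (t t' : R) : Om x -> Om x' -> 0 <= t <= 1 -> 0 <= t' <= 1 ->
    gam x t = gam x' t' -> t = t' /\ (t != 0 -> x = x').
  move=> xO xO' t01 t01' /(congr1 phi); rewrite !phigam //.
  exact: pt_inj.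
have cover w : E w -> cabs (w - z) < r -> cabs (phi w) < s1 ->
    w = z \/ exists x t, [/\ Om x, 0 < t < 1 & gam x t = w].
  move=> Ew wr ws; have [w0|w0] := eqVneq (phi w) 0.
    by left; apply: phi_inj => //; rewrite w0 phiz.
  right; exists (phi w / (cabs (phi w))%:C), (cabs (phi w) / s1).
  have P0 : 0 < cabs (phi w) by rewrite cabs_gt0.
  have xO : Om (phi w / (cabs (phi w))%:C).
    by apply: root_of_Re_pow w0 _; exact/(EP w wr).
  have t01 : 0 < cabs (phi w) / s1 < 1.
    by rewrite divr_gt0 //= ltr_pdivrMr // mul1r.
  split=> //; apply: phi_inj => //.
    by apply: gamr => //; move/andP : t01 => [/ltW -> /ltW ->].
  rewrite phigam //; last by move/andP : t01 => [/ltW -> /ltW ->].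
  rewrite /pt divfK ?gt_eqF // mulrC divfK //.
  by rewrite -cabs_gt0 cabs_real normr_gt0 gt_eqF.
pose s := Num.min r (s1 / (2 * cabs c)).
have s0 : 0 < s by rewrite lt_min r0 divr_gt0 // mulr_gt0.
have phis w : cabs (w - z) < s -> cabs (phi w) < s1.
  rewrite lt_min ltr_pdivlMr ?mulr_gt0 // => /andP[wr ws].
  have := nl _ _ wr zz; have := cabsD (phi w - phi z - c * (w - z)) (c * (w - z)).
  rewrite subrK phiz subr0 cabsM.
  by have := mulr_ge0 (ltW C0) (cabs_ge0 (w - z)); lra.
(* Some ray must exist in order to cover the centre [z] itself. *)
have [x0 x0O] : exists x, Om x.
  by exists ((2 * k).-root (-1)); rewrite /Om /= rootCK.
exists (gam @` Om), s; split=> //; first exact: finite_image.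
- move=> _ [x xO <-]; split; last by rewrite /gam /pt mul0r mul0r psi0.
  have it (t : R) : `]0, 1[%classic t -> 0 <= t <= 1.
    by rewrite /= in_itv /= => /andP[/ltW -> /ltW ->].
  split.
  + exact: gamc.
  + move=> t t'; rewrite !in_itv /= => t01 t01' /(gam_inj x x t t' xO xO t01 t01').
    by case.
  + move=> _ [t /= + <-]; rewrite in_itv /= => t01.
    apply/EP; first exact: gamr.
    by rewrite phigam // exprMn -rmorphXn ReZ Re_pow_root // mulr0.
  (* Relative openness of one open arc: [K] removes the centre and the other arcs, a finite union of
     compact sets, and [N] removes the far end by a strict bound on [phi]. *)
  + pose K := [set z] `|` \bigcup_(x' in Om `\ x) (gam x' @` `[0, 1]).
    have Kc : closed K.
      apply: closedU.
        by apply: compact_closed (@compact_set1 _ z); exact: cHausdorff.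
      apply: closed_bigcup.
        by apply: sub_finite_set Omf => y [].
      move=> y [yO _]; apply: compact_closed; first exact: cHausdorff.
      exact: arc_compact (gamc y yO).
    pose N := [set w | cabs (w - z) < r /\ cabs (phi w) < s1].
    have No : open N.
      move=> w [wr ws]; have := near_linear_cont C2 nl wr => phic.
      have h1 : nbhs w (phi @^-1` [set y | cabs y < s1]).
        apply: phic; apply/cnbhsP; exists (s1 - cabs (phi w)); first by rewrite subr_gt0.
        by move=> y /=; have := cabsB_ge y (phi w); lra.
      have h2 : nbhs w [set y | cabs (y - w) < r - cabs (w - z)].
        by apply/cnbhsP; exists (r - cabs (w - z)); rewrite ?subr_gt0.
      apply: (@filterS2 _ (nbhs w) _ _ _ _ _ h1 h2) => y /= ys yw.
      by split=> //; have := cabs_distD w y z; lra.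
    exists (N `&` ~` K); first by apply: openI => //; exact: closed_openC.
    apply/seteqP; split=> [w [Ew [[wr ws] Kw]]|_ [t t01 <-]].
      have [wz|[y [t [yO t01 gw]]]] := cover w Ew wr ws.
        by exfalso; apply: Kw; left.
      have [yx|yx] := eqVneq y x.
        by exists t; rewrite /= ?in_itv // -yx.
      exfalso; apply: Kw; right; exists y; first by split=> //; apply/eqP.
      by exists t => //; rewrite /= in_itv /=; move/andP : t01 => [/ltW -> /ltW ->].
    have t01' := it t t01; split.
      apply/EP; first exact: gamr.
      by rewrite phigam // exprMn -rmorphXn ReZ Re_pow_root // mulr0.
    move: t01; rewrite /= in_itv /= => /andP[t0 t1].
    split.
      split; first exact: gamr.
      rewrite phigam // cabsM (Om1 x xO) mulr1 cabs_real (gtr0_norm (mulr_gt0 t0 s10)).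
      by rewrite gtr_pMl.
    move=> [/= gz|[y [yO yx] [t' /= +]]].
      have := phigam x t xO t01'; rewrite gz phiz => /(congr1 (@cabs R)).
      rewrite cabs0 cabsM (Om1 x xO) mulr1 cabs_real (gtr0_norm (mulr_gt0 t0 s10)) => /esym/eqP.
      by rewrite gt_eqF // mulr_gt0.
    rewrite in_itv /= => t'01 gy.
    have [tt' h] := gam_inj y x t' t yO xO t'01 t01' gy.
    by apply: yx; apply: h; rewrite tt' gt_eqF.
- move=> w Ew ws; have ws1 := phis w ws.
  have wr : cabs (w - z) < r by move: ws; rewrite lt_min => /andP[].
  have [wz|[y [t [yO /andP[t0 t1] gw]]]] := cover w Ew wr ws1.
    exists (gam x0); first by exists x0.
    exists 0; first by rewrite /= in_itv /= lexx ler01.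
    by rewrite wz /gam /pt mul0r mul0r psi0.
  exists (gam y); first by exists y.
  by exists t => //; rewrite /= in_itv /= !ltW.
Qed.

(** * Graphs from finite families of arcs *)

Definition subarc (R : realType) (g : R -> Cplx R) (a b : R) (t : R) : Cplx R :=
  g (a + t * (b - a)).

Lemma subarc_image (R : realType) (g : R -> Cplx R) (a b : R) : a < b ->
  subarc g a b @` `[0, 1] = g @` `[a, b].
Proof.
move=> ab; apply/seteqP; split=> [_ [t /= + <-]|_ [t /= + <-]];
  rewrite in_itv /= => /andP[t0 t1].
  exists (a + t * (b - a)) => //=; rewrite in_itv /=.
  by apply/andP; split; nra.
have ba : 0 < b - a by lra.
exists ((t - a) / (b - a)); last first.
  by rewrite /subarc divfK ?gt_eqF // addrC subrK.
by rewrite /= in_itv /= ler_pdivlMr // ler_pdivrMr // mul0r mul1r; apply/andP; split; lra.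
Qed.

Lemma subarc_image_oo (R : realType) (g : R -> Cplx R) (a b : R) : a < b ->
  subarc g a b @` `]0, 1[ = g @` `]a, b[.
Proof.
move=> ab; apply/seteqP; split=> [_ [t /= + <-]|_ [t /= + <-]];
  rewrite in_itv /= => /andP[t0 t1].
  exists (a + t * (b - a)) => //=; rewrite in_itv /=.
  by apply/andP; split; nra.
have ba : 0 < b - a by lra.
exists ((t - a) / (b - a)); last first.
  by rewrite /subarc divfK ?gt_eqF // addrC subrK.
by rewrite /= in_itv /= ltr_pdivlMr // ltr_pdivrMr // mul0r mul1r; apply/andP; split; lra.
Qed.

Lemma arc_image_closed (R : realType) (g : R -> Cplx R) (a b : R) :
  cont01 g -> 0 <= a -> b <= 1 -> closed (g @` `[a, b]).
Proof.
move=> gc a0 b1; apply: compact_closed; first exact: cHausdorff.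
apply: continuous_compact; last exact: segment_compact.
apply: continuous_in_subspaceT => t; rewrite inE /= in_itv /= => /andP[t0 t1].
by apply: gc; rewrite (le_trans a0) // (le_trans t1).
Qed.

Lemma subarc_in (R : realType) (L : set (Cplx R)) (g : R -> Cplx R) (a b : R) :
  0 <= a -> a < b -> b <= 1 -> arc_in L g -> arc_in L (subarc g a b).
Proof.
move=> a0 ab b1 [gc gi gL [W oW WE]].
have in01 (t : R) : 0 <= t <= 1 -> 0 <= a + t * (b - a) <= 1.
  by move=> /andP[t0 t1]; apply/andP; split; nra.
split.
- move=> t t01; change {for t, continuous (g \o (fun t => a + t * (b - a)))}.
  apply: continuous_comp.
    apply: (@cvgD _ _ _ _ _ (fun=> a) (fun t => t * (b - a))); first exact: cvg_cst.
    by apply: (@cvgM _ _ _ _ (fun t => t) (fun=> b - a)); [exact: cvg_id|exact: cvg_cst].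
  by apply: gc; exact: in01.
- move=> t t'; rewrite !in_itv /= => t01 t01' /gi.
  rewrite !in_itv /= !in01 // => /(_ erefl erefl)/addrI.
  by apply: mulIf; rewrite gt_eqF // subr_gt0.
- rewrite subarc_image // => _ [t /= + <-]; rewrite in_itv /= => /andP[at_ tb].
  by apply: gL; exists t => //; rewrite /= in_itv /= (le_trans a0) // (le_trans tb).
- rewrite subarc_image_oo //.
  pose K := g @` `[0, a] `|` g @` `[b, 1].
  have Kc : closed K.
    by apply: closedU; apply: arc_image_closed => //; lra.
  exists (W `&` ~` K); first by apply: openI => //; exact: closed_openC.
  rewrite setIA WE; apply/seteqP; split=> [_ [[t /= + <-] tK]|_ [t /= + <-]];
    rewrite in_itv /= => /andP[t0 t1].
    exists t => //=; rewrite in_itv /= !ltNge; apply/andP; split; apply/negP => h;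
      apply: tK; [left|right]; exists t => //=; rewrite in_itv /=.
      by rewrite h ltW.
    by rewrite h ltW.
  split; first by exists t => //=; rewrite in_itv /=; apply/andP; split; lra.
  have t01 : t \in `[0, 1] by rewrite in_itv /=; apply/andP; split; lra.
  move=> [|] [t' /= + tt']; rewrite in_itv /= => /andP[t'0 t'1].
    have : t' = t by apply: gi tt' => //; rewrite in_itv /=; apply/andP; split; lra.
    by lra.
  have : t' = t by apply: gi tt' => //; rewrite in_itv /=; apply/andP; split; lra.
  by lra.
Qed.

Lemma itv01_split (R : realType) (T : Type) (g : R -> T) (w : T) :
  (g @` `[0, 1]) w -> [\/ w = g 0, w = g 1 | (g @` `]0, 1[) w].
Proof.
move=> [t /=]; rewrite in_itv /= => /andP[t0 t1 <-].
have [->|tn0] := eqVneq t 0; first by constructor 1.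
have [->|tn1] := eqVneq t 1; first by constructor 2.
by constructor 3; exists t => //=; rewrite in_itv /= !lt_neqAle eq_sym tn0 t0 tn1 t1.
Qed.

(* The vertices of [s] are removed one at a time from the interiors of the
   arcs, by cutting an arc in two at the vertex. *)
Lemma split_arcs (R : realType) (L V : set (Cplx R)) (A : set (R -> Cplx R))
    (s : seq (Cplx R)) : finite_set A ->
  (forall g, A g -> [/\ arc_in L g, V (g 0) & V (g 1)]) ->
  L `<=` \bigcup_(g in A) (g @` `[0, 1]) ->
  (forall v, v \in s -> V v) ->
  exists B : set (R -> Cplx R), [/\ finite_set B,
    forall g, B g -> [/\ arc_in L g, V (g 0) & V (g 1)],
    L `<=` \bigcup_(g in B) (g @` `[0, 1]) &
    forall g v, B g -> v \in s -> ~ (g @` `]0, 1[) v].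
Proof.
move=> Af AP LA; elim: s => [|v s IH] sV; first by exists A.
have [|B [Bf BP LB Bs]] := IH; first by move=> w ws; apply: sV; rewrite inE ws orbT.
have Vv : V v by apply: sV; rewrite inE eqxx.
pose B0 := [set g | B g /\ ~ (g @` `]0, 1[) v].
pose B1 := [set g | B g /\ (g @` `]0, 1[) v].
have ex (g : R -> Cplx R) : exists t : R, (g @` `]0, 1[) v -> 0 < t < 1 /\ g t = v.
  have [[t /=]|] := pselect ((g @` `]0, 1[) v); last by exists 0.
  by rewrite in_itv /= => t01 gt; exists t.
have [tau tauP] := choice ex.
exists (B0 `|` (fun g => subarc g 0 (tau g)) @` B1 `|`
  (fun g => subarc g (tau g) 1) @` B1); split.
- rewrite !finite_setU; split; [split|].
  + by apply: sub_finite_set Bf => g [].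
  + by apply: finite_image; apply: sub_finite_set Bf => g [].
  + by apply: finite_image; apply: sub_finite_set Bf => g [].
- move=> h [[[Bh _]|[g [Bg gv] <-]]|[g [Bg gv] <-]]; first exact: BP.
    have [/andP[t0 t1] gt] := tauP g gv; have [ga g0 g1] := BP g Bg.
    split; first by apply: subarc_in => //; lra.
      by rewrite /subarc mul0r addr0.
    by rewrite /subarc mul1r subr0 add0r gt.
  have [/andP[t0 t1] gt] := tauP g gv; have [ga g0 g1] := BP g Bg.
  split; first by apply: subarc_in => //; lra.
    by rewrite /subarc mul0r addr0 gt.
  by rewrite /subarc mul1r addrC subrK.
- move=> w /LB[g Bg gw]; have [gv|gv] := pselect ((g @` `]0, 1[) v); last first.
    by exists g => //; left; left.
  have [/andP[t0 t1] gt] := tauP g gv.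
  move: gw => [t /=]; rewrite in_itv /= => /andP[t0' t1'] gtw.
  have [h|h] := leP t (tau g).
    exists (subarc g 0 (tau g)); first by left; right; exists g.
    by rewrite subarc_image //; exists t => //=; rewrite in_itv /= t0'.
  exists (subarc g (tau g) 1); first by right; exists g.
  by rewrite subarc_image //; exists t => //=; rewrite in_itv /= t1' ltW.
- have sub g w (a b : R) : 0 <= a -> b <= 1 -> (g @` `]a, b[) w -> (g @` `]0, 1[) w.
    move=> a0 b1 [t /= + <-]; rewrite in_itv /= => /andP[h1 h2].
    by exists t => //=; rewrite in_itv /=; apply/andP; split; lra.
  (* The cut point is an end of each half, and injectivity keeps it out of their interiors. *)
  have notv g (a b t : R) : B g -> 0 <= a -> b <= 1 -> 0 < t < 1 -> g t = v ->
      t <= a \/ b <= t -> ~ (g @` `]a, b[) v.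
    move=> Bg a0 b1 /andP[t0 t1] gt tab [t' /=].
    rewrite in_itv /= -gt => /andP[h1 h2] tt'; have [ga _ _] := BP g Bg.
    have : t' = t.
      by apply: (arc_inj ga) tt'; rewrite in_itv /=; apply/andP; split; lra.
    by case: tab; lra.
  move=> h w [[[Bh hv]|[g [Bg gv] <-]]|[g [Bg gv] <-]];
    rewrite inE => /orP[/eqP ->|ws] //.
  + exact: Bs.
  + have [/andP[t0 t1] gt] := tauP g gv; rewrite subarc_image_oo //.
    by apply: (notv g _ _ (tau g)) => //; [lra|rewrite t0|right].
  + have [/andP[t0 t1] gt] := tauP g gv; rewrite subarc_image_oo //.
    by move=> gab; apply: (Bs g w Bg ws); apply: (sub _ g w _ _ _ _ gab); lra.
  + have [/andP[t0 t1] gt] := tauP g gv; rewrite subarc_image_oo //.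
    by apply: (notv g _ _ (tau g)) => //; [lra|rewrite t0|left].
  + have [/andP[t0 t1] gt] := tauP g gv; rewrite subarc_image_oo //.
    by move=> gab; apply: (Bs g w Bg ws); apply: (sub _ g w _ _ _ _ gab); lra.
Qed.

(** The trace of the open arc of [h] on that of [g] is closed there: the ends of [h] are vertices,
    which [g] avoids, so the closed arc of [h] has the same trace. Exchanging the arcs gives the
    other inclusion. *)
Lemma arcs_equal_or_disjoint (R : realType) (L V : set (Cplx R))
    (g h : R -> Cplx R) :
  arc_in L g -> arc_in L h -> V (h 0) -> V (h 1) ->
  (forall v, V v -> ~ (g @` `]0, 1[) v) ->
  (g @` `]0, 1[ `&` h @` `]0, 1[) !=set0 ->
  g @` `]0, 1[ `<=` h @` `]0, 1[.
Proof.
move=> ga ha h0 h1 gV gh0.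
have gcon : connected (g @` `]0, 1[).
  apply: connected_continuous_connected; first by apply/connected_intervalP; exact: interval_is_interval.
  apply: continuous_in_subspaceT => t; rewrite inE /= in_itv /= => /andP[t0 t1].
  by apply: (arc_cont ga); rewrite !ltW.
have [W oW WE] := arc_open ha.
have gL : g @` `]0, 1[ `<=` L.
  move=> _ [t /= + <-]; rewrite in_itv /= => /andP[t0 t1]; apply: (arc_sub ga).
  by exists t => //=; rewrite in_itv /= !ltW.
have -> : g @` `]0, 1[ = g @` `]0, 1[ `&` h @` `]0, 1[; last by move=> ? [].
apply/esym/gcon => //.
  exists W => //; rewrite -WE; apply/seteqP; split=> [w [gw [Lw Ww]]|w [gw Ww]] //.
  by split=> //; split=> //; exact: gL.
exists (h @` `[0, 1]); first by apply: arc_image_closed (arc_cont ha) _ _.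
apply/seteqP; split=> [w [gw [t /= + ht]]|w [gw hw]].
  rewrite in_itv /= => /andP[t0 t1]; split=> //.
  by exists t => //=; rewrite in_itv /= !ltW.
split=> //; case: (itv01_split hw) => // wE; exfalso; apply: (gV w) => //; by rewrite wE.
Qed.

Lemma graph_of_arcs (R : realType) (L : set (Cplx R))
    (A : set (R -> Cplx R)) : finite_set A -> (forall g, A g -> arc_in L g) ->
  L `<=` \bigcup_(g in A) (g @` `[0, 1]) -> planar_graph L.
Proof.
move=> Af AP LA.
(* Cuts are made only at points of [V], so they create no new vertices and [V] can be fixed
   beforehand. *)
pose V : set (Cplx R) := (fun g => g 0) @` A `|` (fun g => g 1) @` A.
have Vf : finite_set V by rewrite finite_setU; split; exact: finite_image.
have [s Vs] := (finite_seqP V).1 Vf.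
have [||B [Bf BP LB Bs]] := @split_arcs R L V A s Af _ LA.
- by move=> g Ag; split; [exact: AP|left; exists g|right; exists g].
- by move=> v; rewrite Vs.
have Barc g : B g -> arc_in L g by move=> /BP[].
have BV g v : B g -> V v -> ~ (g @` `]0, 1[) v.
  by move=> Bg; rewrite Vs => vs; exact: Bs.
(* One arc is kept for each open arc, seen as a point set. *)
pose rep (P : set (Cplx R)) : R -> Cplx R :=
  xget (fun=> 0) [set h | B h /\ h @` `]0, 1[ = P].
have repP g : B g ->
    B (rep (g @` `]0, 1[)) /\ rep (g @` `]0, 1[) @` `]0, 1[ = g @` `]0, 1[.
  by move=> Bg; rewrite /rep; case: xgetP => [h _ //|/(_ g)[]].
pose C := (fun g => rep (g @` `]0, 1[)) @` B.
have Cf : finite_set C by exact: finite_image.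
have CB g : C g -> B g by move=> [h /repP[Bh _] <-].
have C_eq g h : C g -> C h -> g @` `]0, 1[ = h @` `]0, 1[ -> g = h.
  move=> [g' Bg' <-] [h' Bh' <-].
  by rewrite (repP _ Bg').2 (repP _ Bh').2 => ->.
have [t' Ct'] := (finite_seqP _).1 Cf.
(* Without repetitions, distinct indices give distinct arcs, as disjointness of edges requires. *)
pose t := undup t'.
have Ct g : (g \in t) <-> C g by rewrite Ct' /t /= mem_undup.
have tC i : (i < size t)%N -> C (nth (fun=> 0) t i).
  by move=> it; apply/Ct; exact: mem_nth.
left; exists V, (size t), (fun i : 'I_(size t) => nth (fun=> 0) t i); split.
  split=> //.
  - by move=> i; apply: cont01_within; apply: arc_cont (Barc _ (CB _ (tC i (ltn_ord i)))).
  - by move=> i; have [] := BP _ (CB _ (tC i (ltn_ord i))).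
  - move=> i x y xi yi.
    have oc u : u \in `]0, 1[ -> u \in `[0, 1 : R].
      by rewrite !in_itv /= => /andP[/ltW -> /ltW ->].
    by apply: (arc_inj (Barc _ (CB _ (tC i (ltn_ord i))))); exact: oc.
  - move=> i; apply/disj_setPS => w [gw Vw].
    exact: (BV _ _ (CB _ (tC i (ltn_ord i))) Vw gw).
  - move=> i j ij; apply/disj_setPS => w ghw; exfalso.
    have Bi := CB _ (tC i (ltn_ord i)); have Bj := CB _ (tC j (ltn_ord j)).
    have [ai i0 i1] := BP _ Bi; have [aj j0 j1] := BP _ Bj.
    move/eqP : ij; apply; apply/val_inj/eqP.
    rewrite -(nth_uniq (fun=> 0) (ltn_ord i) (ltn_ord j) (undup_uniq t')).
    apply/eqP; apply: C_eq; [exact: tC|exact: tC|apply/seteqP; split].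
      apply: (arcs_equal_or_disjoint ai aj j0 j1); last by exists w.
      by move=> v Vv; exact: BV.
    apply: (arcs_equal_or_disjoint aj ai i0 i1).
      by move=> v Vv; exact: BV.
    by exists w; case: ghw.
apply/seteqP; split=> [w Lw|w [Vw|[i _]]].
- have [g Bg gw] := LB w Lw; have [ga g0 g1] := BP g Bg.
  have [->|->|gw'] := itv01_split gw; [by left|by left|right].
  have [_ hE] := repP g Bg.
  have Cg : C (rep (g @` `]0, 1[)) by exists g.
  move: hE Cg; set h := rep _ => hE Ch.
  have it : (index h t < size t)%N by rewrite index_mem; exact/Ct.
  exists (Ordinal it) => //=; rewrite nth_index; last exact/Ct.
  move: gw'; rewrite -hE => -[x /= + <-]; rewrite in_itv /= => /andP[x0 x1].
  by exists x => //=; rewrite in_itv /= !ltW.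
- case: Vw => -[g Ag <-]; apply: (arc_sub (AP g Ag)).
    by exists 0 => //=; rewrite in_itv /= lexx ler01.
  by exists 1 => //=; rewrite in_itv /= lexx ler01.
- exact: (arc_sub (Barc _ (CB _ (tC i (ltn_ord i))))).
Qed.

(** * Level sets *)

Lemma near_linear_sub (R : realType) (phi : Cplx R -> Cplx R) (z w c : Cplx R)
    (r s e : R) : cabs (w - z) + s <= r ->
  near_linear phi z r c e -> near_linear phi w s c e.
Proof.
move=> wr nl x x' xs xs'; apply: nl.
  by have := cabs_distD w x z; lra.
by have := cabs_distD w x' z; lra.
Qed.

(** [phi] is open near [w], so its values fill a disk around [y = phi w]. If [y = 0], a small
    positive real has a power with positive real part; otherwise the power map is open at [y] and
    reaches [y ^ k + t] with [t > 0]. *)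
Lemma normal_form_no_interior (R : realType) (phi : Cplx R -> Cplx R)
    (z w c : Cplx R) (r : R) (k : nat) : (0 < k)%N -> c != 0 ->
  near_linear phi z r c (cabs c / 2) -> cabs (w - z) < r ->
  ~ nbhs w [set x | complex.Re (phi x ^+ k) = 0].
Proof.
move=> k0 c0 nl wr /cnbhsP[d0 d00 Hd].
have C0 : 0 < cabs c by rewrite cabs_gt0.
pose d := Num.min d0 (r - cabs (w - z)).
have d_gt0 : 0 < d by rewrite lt_min d00 subr_gt0.
have dd0 : d <= d0 by rewrite ge_min lexx.
have dr : cabs (w - z) + d <= r.
  have : d <= r - cabs (w - z) by rewrite ge_min lexx orbT.
  by lra.
have nlw := near_linear_sub dr nl.
pose y := phi w; pose q := cabs c * d / 8.
have q0 : 0 < q by rewrite divr_gt0 // mulr_gt0.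
have Re0 y' : cabs (y' - y) < q -> complex.Re (y' ^+ k) = 0.
  move=> /(near_linear_surj d_gt0 c0 nlw)[x xw <-]; apply: Hd; lra.
clearbody q.
have [y0|yN0] := eqVneq y 0.
  have : complex.Re ((q / 2)%:C ^+ k : Cplx R) = 0.
    apply: Re0; rewrite y0 subr0 cabs_real gtr0_norm ?divr_gt0 //; lra.
  rewrite -rmorphXn /= => /eqP; rewrite expf_eq0 k0 /= => /eqP; lra.
pose c' : Cplx R := k%:R * y ^+ k.-1.
have c'0 : c' != 0 by rewrite mulf_neq0 ?expf_neq0 // pnatr_eq0 -lt0n.
have C'0 : 0 < cabs c' by rewrite cabs_gt0.
have C'2 : 0 < cabs c' / 2 by rewrite divr_gt0.
have [rho0 rho00 nlp0] := expr_near_linear y k C'2.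
pose rho := Num.min rho0 q.
have rho_gt0 : 0 < rho by rewrite lt_min rho00.
have yy : cabs (y - y) + rho <= rho0 by rewrite subrr cabs0 add0r ge_min lexx.
have nlp := near_linear_sub yy nlp0.
have rq : rho <= q by rewrite ge_min lexx orbT.
(* Half of the displacement that [near_linear_surj] allows. *)
pose t := cabs c' * rho / 16.
have t0 : 0 < t by rewrite divr_gt0 // mulr_gt0.
have [|y' y'y y'E] := @near_linear_surj _ _ y c' (y ^+ k + t%:C) rho rho_gt0 c'0 nlp.
  rewrite addrAC subrr add0r cabs_real gtr0_norm // /t.
  by have := mulr_gt0 C'0 rho_gt0; lra.
have y'q : cabs (y' - y) < q by lra.
have yq : cabs (y - y) < q by rewrite subrr cabs0.
have := Re0 y' y'q; rewrite y'E ReD (Re0 y yq) add0r /= => te.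
by rewrite te ltxx in t0.
Qed.

Lemma Re_div (R : realType) (a b : Cplx R) : complex.Re (a / b) =
  (complex.Re a * complex.Re b + complex.Im a * complex.Im b) / cabs b ^+ 2.
Proof.
rewrite cabs_def; case: a b => [x y] [u v].
rewrite /GRing.inv /GRing.mul /= -/(GRing.mul _ _).
by rewrite mulrN opprK mulrDl !mulrA.
Qed.

(** The numerator of the real part is |u| ^ 2 - |v| ^ 2. *)
Lemma Re_cayley (R : realType) (u v : Cplx R) : u + v != 0 ->
  complex.Re ((u - v) / (u + v)) = 0 <-> cabs u = cabs v.
Proof.
move=> uv; have uv0 : cabs (u + v) ^+ 2 != 0 by rewrite expf_neq0 // cabs_eq0.
rewrite Re_div ReB ImB ReD ImD.
have -> : (complex.Re u - complex.Re v) * (complex.Re u + complex.Re v) +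
    (complex.Im u - complex.Im v) * (complex.Im u + complex.Im v) =
    cabs u ^+ 2 - cabs v ^+ 2 by rewrite !cabs_def; ring.
split=> [/eqP|->]; last by rewrite subrr mul0r.
rewrite mulf_eq0 invr_eq0 (negbTE uv0) orbF subr_eq0 eqrXn2 ?cabs_ge0 //.
by move/eqP.
Qed.

Lemma near_and_at (T : topologicalType) (z : T) (P : set T) :
  (\forall w \near z^', P w) -> P z -> nbhs z P.
Proof.
move=> zP Pz; have : nbhs z [set w | w != z -> P w] by [].
apply: filterS => w wP; have [->//|] := pselect (w = z).
by move=> /eqP; exact: wP.
Qed.

Lemma meromorphic_near (R : realType) (f : Cplx R -> sphere R)
    (U : set (Cplx R)) (z : Cplx R) : open U -> meromorphic_on f U ->
  U z -> f z <> None ->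
  exists2 r : R, 0 < r & forall w, cabs (w - z) < r ->
    [/\ U w, f w <> None & derivable (fun w => finite_value (f w)) w 1].
Proof.
move=> oU [fi fd _] Uz fz.
have /cnbhsP[r1 r10 H1] : nbhs z U by exact: open_nbhs_nbhs.
have /cnbhsP[r2 r20 H2] := near_and_at (fi z Uz) fz.
exists (Num.min r1 r2); first by rewrite lt_min r10.
move=> w; rewrite lt_min => /andP[/H1 Uw /H2 fw].
by split=> //; exact: fd.
Qed.

Lemma meromorphic_pole_big (R : realType) (f : Cplx R -> sphere R)
    (U : set (Cplx R)) (z : Cplx R) (M : R) : meromorphic_on f U ->
  U z -> f z = None ->
  exists2 r : R, 0 < r & forall w, cabs (w - z) < r -> w != z ->
    M < cabs (finite_value (f w)).
Proof.
move=> [_ _ fp] Uz fz.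
have : nbhs (+oo : set_system (Cplx R)) [set y | M%:C < y].
  by exists M%:C; split=> //; rewrite complex_real.
move=> /(fp z Uz fz) H.
have /cnbhsP[r r0 rH] : nbhs z [set w | w != z -> M%:C < `|finite_value (f w)|] by exact: H.
by exists r => // w wz wNz; have := rH w wz wNz; rewrite normcE ltcR.
Qed.

Lemma level_setP (R : realType) (f : Cplx R -> sphere R)
    (U : set (Cplx R)) (eps : R) (z : Cplx R) : level_set f U eps z <->
  [/\ U z, f z <> None & cabs (finite_value (f z)) = eps].
Proof.
split=> -[Uz fz fe]; split=> //.
  by move: fe; rewrite normcE => /complexI.
by rewrite normcE fe.
Qed.

(** A pole is not a limit of level points, since the modulus exceeds [eps] around it; elsewhere the
    modulus is continuous. *)
Lemma level_set_closed (R : realType) (f : Cplx R -> sphere R)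
    (U : set (Cplx R)) (eps : R) (z : Cplx R) : open U -> meromorphic_on f U ->
  U z -> closure (level_set f U eps) z -> level_set f U eps z.
Proof.
move=> oU fm Uz cz.
have [fz|fz] := pselect (f z = None).
  have [r r0 rH] := meromorphic_pole_big eps fm Uz fz.
  have [|w [/level_setP[Uw fw we] wz]] := cz [set w | cabs (w - z) < r].
    by apply/cnbhsP; exists r.
  have wNz : w != z by apply/eqP => e; apply: fw; rewrite e.
  by have := rH w wz wNz; rewrite we ltxx.
apply/level_setP; split=> //.
have fc := derivable_ccontinuous (meromorphic_derivable fm Uz fz).
apply/eqP; rewrite -subr_eq0 -normr_eq0 eq_le normr_ge0 andbT.
apply/ler_addgt0Pr => e e0; rewrite add0r.
have /fc : nbhs (finite_value (f z)) [set y | cabs (y - finite_value (f z)) < e].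
  by apply/cnbhsP; exists e.
move=> /cz[w [/level_setP[Uw fw we] /= wz]].
have := cabsB_ge (finite_value (f z)) (finite_value (f w)).
have := cabsB_ge (finite_value (f w)) (finite_value (f z)).
rewrite (cabsC (finite_value (f z))) we ler_norml => h1 h2.
by apply/andP; split; lra.
Qed.

Lemma level_set_local (R : realType) (f : Cplx R -> sphere R)
    (U : set (Cplx R)) (eps : R) (z : Cplx R) : open U -> meromorphic_on f U ->
  0 < eps -> level_set f U eps z ->
  nbhs z (level_set f U eps) \/
  exists k phi r c, [/\ (0 < k)%N, 0 < r, c != 0 & phi z = 0] /\
    near_linear phi z r c (cabs c / 2) /\
    forall w, cabs (w - z) < r ->
      level_set f U eps w <-> complex.Re (phi w ^+ k) = 0.
Proof.
move=> oU fm eps0 /level_setP[Uz fz fze].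
pose F w := finite_value (f w).
have [r1 r10 H1] := meromorphic_near oU fm Uz fz.
have zz : cabs (z - z) < r1 by rewrite subrr cabs0.
have Fc : {for z, continuous F}.
  by apply: derivable_ccontinuous; have [] := H1 z zz.
(* Since [F z] has modulus [eps], values within [eps] of it cannot equal [- F z], so the denominator
   of [g] does not vanish. *)
have /Fc/cnbhsP[r2 r20 H2] : nbhs (F z) [set y | cabs (y - F z) < eps].
  by apply/cnbhsP; exists eps.
pose r := Num.min r1 r2; have r0 : 0 < r by rewrite lt_min r10.
have FFz w : cabs (w - z) < r -> F w + F z != 0.
  rewrite lt_min => /andP[_ /H2 /= h]; apply/eqP => e.
  have := cabsB_ge (F z + F z) (F z - F w).
  rewrite (_ : F z + F z - (F z - F w) = F w + F z); last by ring.
  rewrite e cabs0 (cabsC (F z)) -mulr2n -mulr_natl cabsM cabs_nat fze.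
  by move: h; lra.
pose g w := (F w - F z) / (F w + F z).
have gz : g z = 0 by rewrite /g subrr mul0r.
have dg w : cabs (w - z) < r -> derivable g w 1.
  move=> wr; have [_ _ dF] : [/\ U w, f w <> None & derivable F w 1].
    by apply: H1; move: wr; rewrite lt_min => /andP[].
  apply: derivableM.
    by apply: derivableB; [exact: dF|exact: derivable_cst].
  apply: derivableV; first exact: FFz.
  by apply: derivableD; [exact: dF|exact: derivable_cst].
have gP w : cabs (w - z) < r -> level_set f U eps w <-> complex.Re (g w) = 0.
  move=> wr; have [Uw fw _] : [/\ U w, f w <> None & derivable F w 1].
    by apply: H1; move: wr; rewrite lt_min => /andP[].
  rewrite (Re_cayley (FFz w wr)) fze; split=> [/level_setP[]//|we].
  exact/level_setP.
have [[s s0 gs]|] := local_normal_form r0 gz dg.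
  left; apply/cnbhsP; exists (Num.min r s); first by rewrite lt_min r0.
  by move=> w; rewrite lt_min => /andP[wr ws]; apply/gP => //; rewrite gs.
move=> [k [phi [s [c [[k0 s0 sr c0 phiz] [nl gE]]]]]]; right.
exists k, phi, s, c; split=> //; split=> // w ws.
by rewrite -gE // gP // (lt_le_trans ws).
Qed.

(** The closure of [L] lies in that of [G], hence in [G'], where the level set is relatively closed.
    Being connected, it is contained in the component [L]. *)
Lemma component_compact (R : realType) (G G' : set (Cplx R))
    (f : Cplx R -> sphere R) (eps : R) (L : set (Cplx R)) :
  open G' -> closure G `<=` G' -> meromorphic_on f G' ->
  is_component (level_set f G' eps) L -> bounded_set L -> L `<=` G ->
  compact L.
Proof.
move=> oG' GG' fm [x Ex LE] Lb LG; apply: compact_bounded_closed => //.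
have LE' : L `<=` level_set f G' eps by rewrite LE; exact: connected_component_sub.
have cLE : closure L `<=` level_set f G' eps.
  move=> w cw; apply: level_set_closed => //.
    by apply: GG'; exact: closure_subset cw.
  exact: closure_subset cw.
have Lcon : connected L by rewrite LE; exact: component_connected.
have Lx : L x by rewrite LE; exact: connected_component_refl.
move=> w cw; rewrite LE; apply: connected_component_max cw => //.
  exact: subset_closure.
exact: connected_closure.
Qed.

Lemma component_max (R : realType) (E L B : set (Cplx R)) (z : Cplx R) :
  is_component E L -> L z -> B z -> B `<=` E -> connected B -> B `<=` L.
Proof.
move=> [x Ex ->] Lz Bz BE Bc.
by rewrite (same_connected_component Lz); exact: connected_component_max.
Qed.

Lemma disk_connected (R : realType) (z : Cplx R) (r : R) :
  connected [set w : Cplx R | cabs (w - z) < r].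
Proof.
have [r0|r0] := ltP 0 r; last first.
  suff -> : [set w : Cplx R | cabs (w - z) < r] = set0 by exact: connected0.
  apply/seteqP; split=> // w /= wr.
  by have := le_lt_trans (cabs_ge0 _) (lt_le_trans wr r0); rewrite ltxx.
have -> : [set w : Cplx R | cabs (w - z) < r] =
    \bigcup_(w in [set w : Cplx R | cabs (w - z) < r]) (segpt z w @` `[0, 1]).
  apply/seteqP; split=> [w wr|_ [w /= wr [t /= + <-]]].
    exists w => //; exists 1; first by rewrite /= in_itv /= lexx ler01.
    by rewrite /segpt mul1r addrC subrK.
  rewrite in_itv /= => /andP[t0 t1].
  rewrite /segpt addrAC subrr add0r cabsM cabs_real ger0_norm //.
  by apply: le_lt_trans wr; rewrite ler_piMl ?cabs_ge0.
apply: bigcup_connected.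
  exists z => w _; exists 0; first by rewrite /= in_itv /= lexx ler01.
  by rewrite /segpt mul0r addr0.
move=> w _; apply: connected_continuous_connected.
  by apply/connected_intervalP; exact: interval_is_interval.
apply: continuous_subspaceT; exact: segpt_continuous.
Qed.

Lemma component_no_interior (R : realType) (G G' : set (Cplx R))
    (f : Cplx R -> sphere R) (eps : R) (L : set (Cplx R)) (z : Cplx R) :
  open G' -> closure G `<=` G' -> meromorphic_on f G' -> 0 < eps ->
  is_component (level_set f G' eps) L -> bounded_set L -> L `<=` G ->
  L z -> ~ nbhs z (level_set f G' eps).
Proof.
move=> oG' GG' fm eps0 Lc Lb LG Lz Ez; set E := level_set f G' eps in Lc Ez.
have Lk := component_compact oG' GG' fm Lc Lb LG.
have Lcl : closed L by apply: compact_closed => //; exact: cHausdorff.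
have LE : L `<=` E by case: Lc => x _ ->; exact: connected_component_sub.
pose W := [set w | L w /\ nbhs w E].
(* At a limit point of [W] the normal form is impossible, because it excludes interior points at all
   nearby [v], and not only at its centre. *)
have Wcl : closed W.
  move=> w cw; have Lw : L w.
    by apply: Lcl; apply: closure_subset cw => v [].
  split; first exact: Lw.
  have [Ew|] := level_set_local oG' fm eps0 (LE w Lw); first exact: Ew.
  move=> [k [phi [r [c [[k0 r0 c0 phiw] [nl EP]]]]]]; exfalso.
  have wr : nbhs w [set v | cabs (v - w) < r] by apply/cnbhsP; exists r.
  have [v [[Lv vE] /= vr]] := cw _ wr.
  apply: (normal_form_no_interior k0 c0 nl vr).
  have vr' : nbhs v [set x | cabs (x - v) < r - cabs (v - w)].
    by apply/cnbhsP; exists (r - cabs (v - w)); rewrite ?subr_gt0.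
  apply: (@filterS2 _ (nbhs v) _ _ _ _ _ vE vr') => x Ex /= xv.
  by apply/(EP x); [have := cabs_distD v x w; lra|exact: Ex].
have Wk : compact W by apply: subclosed_compact Wcl Lk _ => w [].
have Rec : {within W, continuous (@complex.Re R : Cplx R -> R)}.
  by apply: continuous_subspaceT; exact: Re_continuous.
have W0 : W !=set0 by exists z.
have [p /set_mem Wp pmax] := compact_EVT_max W0 Wk Rec.
have [Lp /cnbhsP[d d0 pE]] := Wp.
(* A shift to the right inside a disk of the level set; the disk is connected, so the shifted point
   stays in [L] and has a larger real part. *)
pose p' : Cplx R := p + (d / 2)%:C.
have p'p : cabs (p' - p) < d.
  by rewrite /p' addrAC subrr add0r cabs_real gtr0_norm ?divr_gt0 //; lra.
have pp : cabs (p - p) < d by rewrite subrr cabs0.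
have Wp' : W p'.
  split; first exact: (component_max Lc Lp pp pE (disk_connected (r := d)) p'p).
  apply/cnbhsP; exists (d - cabs (p' - p)); first by rewrite subr_gt0.
  by move=> w wp'; apply: pE; have := cabs_distD p' w p; lra.
by have := pmax p' (mem_set Wp'); rewrite ReD /=; lra.
Qed.

Theorem proposition2p1 (R : realType) (G G' : set (Cplx R))
    (f : Cplx R -> sphere R) (eps : R) (L : set (Cplx R)) :
  open G -> open G' -> closure G `<=` G' ->
  meromorphic_on f G' ->
  0 < eps ->
  is_component (level_set f G' eps) L ->
  bounded_set L ->
  L `<=` G ->
  planar_graph L.
Proof.
move=> _ oG' GG' fm eps0 Lc Lb LG; pose E := level_set f G' eps.
have Lk := component_compact oG' GG' fm Lc Lb LG.
have LE : L `<=` E by case: Lc => x _ ->; exact: connected_component_sub.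
have local (z : Cplx R) : exists p : set (R -> Cplx R) * R,
    L z -> [/\ finite_set p.1, 0 < p.2, forall g, p.1 g -> arc_in L g &
      forall w, L w -> cabs (w - z) < p.2 ->
        exists2 g, p.1 g & (g @` `[0, 1]) w].
  have [Lz|Lz] := pselect (L z); last by exists (set0, 0).
  have [Ez|] := level_set_local oG' fm eps0 (LE z Lz).
    by have := component_no_interior oG' GG' fm eps0 Lc Lb LG Lz Ez.
  move=> [k [phi [r [c [[k0 r0 c0 phiz] [nl EP]]]]]].
  have [A [s [Af s0 AE Acov]]] := star k0 r0 c0 phiz nl EP.
  exists (A, s) => _; split=> //= [g /AE[gE gz]|w Lw]; last exact/Acov/LE.
  (* A star is built in the whole level set; each of its arcs is connected and meets [L] at [z], so
     it lies in the component. *)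
  have gL : g @` `[0, 1] `<=` L.
    apply: (component_max Lc Lz _ (arc_sub gE)).
      by exists 0 => //; rewrite /= in_itv /= lexx ler01.
    apply: connected_continuous_connected (cont01_within (arc_cont gE)).
    by apply/connected_intervalP; exact: interval_is_interval.
  have [U oU UE] := arc_open gE.
  (* The open set [U] that isolates the arc in the level set also isolates it in the smaller set
     [L]. *)
  split; [exact: arc_cont gE|exact: arc_inj gE|exact: gL|exists U => //].
  apply/seteqP; split=> [w [Lw Uw]|w gw].
    by rewrite -UE; split=> //; exact: LE.
  have [_ Uw] : (E `&` U) w by rewrite UE.
  split=> //; apply: gL; move: gw => [t /= + <-]; rewrite in_itv /= => /andP[t0 t1].
  by exists t => //=; rewrite in_itv /= !ltW.
have [F FP] := choice local.
pose B z := [set w : Cplx R | cabs (w - z) < (F z).2].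
have Bo z : open (B z).
  move=> w wz; apply/cnbhsP; exists ((F z).2 - cabs (w - z)).
    by rewrite subr_gt0.
  by move=> v vw; rewrite /B /=; have := cabs_distD w v z; lra.
have := Lk; rewrite compact_cover => /(_ _ L B (fun z _ => Bo z)) [].
  by move=> z Lz; exists z => //; have [_ s0 _ _] := FP z Lz; rewrite /B /= subrr cabs0.
move=> D DL LD.
have DL' : [set` D] `<=` L by move=> z zD; apply: set_mem; exact: DL.
apply: (@graph_of_arcs R L (\bigcup_(z in [set` D]) (F z).1)).
- apply: bigcup_finite; first exact: finite_fset.
  by move=> z /DL' /FP[].
- by move=> g [z /DL' /FP[_ _ + _]]; exact.
- move=> w Lw; have [z zD wz] := LD w Lw.
  have [_ _ _ /(_ w Lw wz)[g gA gw]] := FP z (DL' z zD).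
  by exists g => //; exists z.
Qed.
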